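(* Let $r\ge 0$ and $n\ge 1$ be integers, and let $\mathcal F$ be an $r$-multiply saturated formation such that $\mathcal N\subseteq \mathcal F\subseteq \mathcal N^{r+1}$. Let $G$ be a finite soluble group. If every $n$-maximal subgroup of $G$ is $\mathcal F$-subnormal in $G$ and $|\pi(G)|\ge n+r+1$, then $G\in\mathcal F$.
   Context: All groups are finite. $\pi(G)$ is the set of prime divisors of $|G|$; $\mathcal N$ is the class of all nilpotent groups; for $s\ge 1$, $\mathcal N^{s}$ is the class of all soluble groups of nilpotent length at most $s$. For a class $\mathcal F$ of groups with $1\in\mathcal F$, $G^{\mathcal F}$ is the intersection of all normal subgroups $N$ of $G$ with $G/N\in\mathcal F$. A class $\mathcal F$ is a formation if either $\mathcal F=\emptyset$, or $1\in\mathcal F$ and every homomorphic image of $G/G^{\mathcal F}$ belongs to $\mathcal F$ for any group $G$. For a function $f$ assigning to each prime $p$ a formation $f(p)$, $LF(f)$ is the class of all groups $G$ such that either $G=1$, or $G\neq1$ and $G/C_G(H/K)\in f(p)$ for every chief factor $H/K$ of $G$ and every prime $p$ dividing $|H/K|$. Every formation is $0$-multiply saturated; for $m\ge1$, a formation $\mathcal F$ is $m$-multiply saturated if $\mathcal F=LF(f)$ for some such $f$ all of whose non-empty values are $(m-1)$-multiply saturated formations. A $1$-maximal subgroup of $G$ is a maximal subgroup of $G$; for $n\ge2$, an $n$-maximal subgroup of $G$ is a maximal subgroup of some $(n-1)$-maximal subgroup of $G$. For a non-empty formation $\mathcal F$, a subgroup $H$ of $G$ is $\mathcal F$-subnormal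 in $G$ if either $H=G$ or there is a chain $H=H_0<H_1<\dots<H_k=G$ such that, for $i=1,\dots,k$, $H_{i-1}$ is a maximal subgroup of $H_i$ and $H_i/(H_{i-1})_{H_i}\in\mathcal F$, where $(H_{i-1})_{H_i}$ is the core of $H_{i-1}$ in $H_i$ (the largest normal subgroup of $H_i$ contained in $H_{i-1}$). *)

(* Defs.v *)
From mathcomp Require Import all_boot all_fingroup all_solvable.
From mathcomp Require Import boolp.

Set Implicit Arguments.
Unset Strict Implicit.
Unset Printing Implicit Defensive.

Local Open Scope group_scope.

(* Finite groups are represented as subgroups of arbitrary ambient finite
   groups. That a class depends only on the isomorphism type of its members is
   the separate condition [iso_closed]. *)
Definition group_class := forall gT : finGroupType, {group gT} -> Prop.

Definition iso_closed (F : group_class) :=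
  forall (gT rT : finGroupType) (G : {group gT}) (H : {group rT}),
    G \isog H -> F gT G -> F rT H.

Definition class_nonempty (F : group_class) :=
  exists (gT : finGroupType) (G : {group gT}), F gT G.

Definition class_sub (E F : group_class) :=
  forall (gT : finGroupType) (G : {group gT}), E gT G -> F gT G.

Definition class_eq (E F : group_class) :=
  forall (gT : finGroupType) (G : {group gT}), E gT G <-> F gT G.

(* G^F. It is meaningful only when 1 belongs to F: then N = G is one of the
   groups being intersected, so the result is a subgroup of G. *)
Definition residual (F : group_class) (gT : finGroupType) (G : {group gT}) :
    {group gT} :=
  (\bigcap_(N : {group gT} | (N <| G) && `[< F _ (G / N)%G >]) N)%G.

Definition formation (F : group_class) :=
  iso_closed F /\
  (~ class_nonempty F \/
   (forall gT : finGroupType, F gT 1%G) /\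
   (forall (gT : finGroupType) (G : {group gT}) (rT : finGroupType)
           (phi : {morphism (G / residual F G) >-> rT}),
      F rT (phi @* (G / residual F G))%G)).

(* [chief_factor G K H] says that H / K is a chief factor of G, and
   'C_G(H / K | 'Q) is the centraliser C_G(H/K), a normal subgroup of G. *)
Definition LF (f : nat -> group_class) : group_class := fun gT G =>
  G :=: 1 \/
  (G :!=: 1 /\
   forall (H K : {group gT}) (p : nat),
     chief_factor G K H -> prime p -> p %| #|H / K| ->
     f p _ (G / 'C_G(H / K | 'Q))%G).

(* Only the values of f at primes matter. *)
Fixpoint multiply_saturated (m : nat) (F : group_class) : Prop :=
  if m is m'.+1 then
    formation F /\
    exists f : nat -> group_class,
      [/\ forall p, prime p -> formation (f p),
          class_eq F (LF f)
        & forall p, prime p -> class_nonempty (f p) ->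
            multiply_saturated m' (f p)]
  else formation F.

Definition nilpotent_groups : group_class := fun gT G => nilpotent G.

(* The terms F_0(G) = 1, F_i+1(G) / F_i(G) = 'F(G / F_i(G)) of the ascending
   Fitting series. *)
Definition upper_fitting_at (i : nat) (gT : finGroupType) (G : {group gT}) :
    {group gT} :=
  iter i (fun B : {group gT} => coset B @*^-1 'F(G / B))%G 1%G.

(* The least i with F_i(G) = G. For soluble G the series increases strictly
   until it reaches G, so such an i exists below #|G|; when there is no such i
   (G insoluble) the value is #|G|. *)
Definition nilpotent_length (gT : finGroupType) (G : {group gT}) : nat :=
  index G (mkseq (fun i => upper_fitting_at i G) #|G|).

Definition nilpotent_length_le (s : nat) : group_class :=
  fun gT G => solvable G /\ nilpotent_length G <= s.

Inductive n_maximal (gT : finGroupType) (G : {group gT}) :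
    nat -> {group gT} -> Prop :=
  | n_maximal1 (M : {group gT}) : maximal M G -> n_maximal G 1 M
  | n_maximalS (n : nat) (M H : {group gT}) :
      n_maximal G n M -> maximal H M -> n_maximal G n.+1 H.

(* The case H = G is the chain of length k = 0. *)
Definition F_subnormal (F : group_class) (gT : finGroupType)
    (H G : {group gT}) : Prop :=
  exists (k : nat) (C : nat -> {group gT}),
    [/\ C 0 = H, C k = G
      & forall i, i < k ->
          maximal (C i) (C i.+1) /\ F _ (C i.+1 / gcore (C i) (C i.+1))%G].

(* Main.v *)
(* A local formation F = LF(f) contains a soluble group G iff G/O_{p',p}(G) lies
   in f(p) for every prime p dividing |G|, because O_{p',p}(G) is the
   intersection of the centralisers of the p-chief factors. One may replace f(p)
   by its intersection with N^r, so by induction on r the formation F is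
   closed under subgroups; the base case, that formations of nilpotent groups
   are subgroup-closed, is the theorem of Bryant, Bryce and Hartley.

   If G is soluble, all its maximal subgroups lie in F, and G does not, then
   |pi(G)| <= r + 2. For the induction on r one proves more: for any p, a
   soluble group outside N_p F all of whose maximal subgroups lie in N_p F has at
   most r + 2 prime divisors different from p. Such a group has a primitive
   quotient V : T with V a q-group and the same primes, and T is again critical,
   either for N_q f(q) or for F.

   If all n-maximal subgroups are F-subnormal, then for every (n-1)-maximal
   subgroup M and every H maximal in M, the quotient of M by the core of H lies
   in F, whence M is in F by saturation. Maximal subgroups of a soluble group lose
   at most one prime, so the bound on critical groups carries membership in F up
   from the (n-1)-maximal subgroups to G. *)
Require Import Defs.
From mathcomp Require Import all_boot all_fingroup all_solvable.
From mathcomp Require Import boolp.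

Set Implicit Arguments.
Unset Strict Implicit.
Unset Printing Implicit Defensive.

Local Open Scope group_scope.

(** * Formations *)

Section Formations.

Variable F : group_class.
Hypothesis formF : formation F.

Lemma formation_isog (gT rT : finGroupType) (G : {group gT}) (H : {group rT}) :
  G \isog H -> F G -> F H.
Proof. by case: formF => isoF _; apply: isoF. Qed.

Lemma formation1 (gT rT : finGroupType) (G : {group gT}) (H : {group rT}) :
  F G -> H :=: 1 -> F H.
Proof.
move=> FG H1; case: formF => isoF [[]|[F1 _]]; first by exists gT, G.
by apply: isoF (F1 rT); rewrite isog_sym; apply: trivial_isog.
Qed.

Lemma residual_sub (gT : finGroupType) (G N : {group gT}) :
  N <| G -> F (G / N)%G -> residual F G \subset N.
Proof.
by move=> nNG FGN; rewrite /= bigcap_inf // nNG; apply/asboolP.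
Qed.

Lemma residual_normal (gT : finGroupType) (G : {group gT}) :
  class_nonempty F -> residual F G <| G.
Proof.
case=> hT [H FH].
have sRG: residual F G \subset G.
  by apply: residual_sub => //; apply: formation1 FH _; apply: trivg_quotient.
rewrite /normal sRG /=; apply/normsP => x Gx.
apply/eqP; rewrite eqEcard cardJg leqnn andbT.
apply/bigcapsP => N /andP[nNG FGN].
by rewrite -(normsP (normal_norm nNG) x Gx) conjSg bigcap_inf // nNG.
Qed.

Lemma formation_residual (gT : finGroupType) (G : {group gT}) :
  class_nonempty F -> F (G / residual F G)%G.
Proof.
move=> neF; case: formF => isoF [//|[_ /(_ gT G _ (idm_morphism _))]].
by apply: isoF; rewrite /= morphim_idm ?isog_refl.
Qed.

Lemma formation_homg (gT rT : finGroupType) (G : {group gT}) (H : {group rT}) :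
  H \homg G -> F G -> F H.
Proof.
move=> hHG FG; have neF: class_nonempty F by exists gT, G.
have R1: residual F G :=: 1.
  apply/trivgP; apply: (residual_sub (N := 1%G)) (normal1 G) _.
  by apply: formation_isog FG; rewrite /= quotient1_isog.
have: H \homg G / residual F G.
  by apply: homg_trans hHG _; rewrite R1 isog_hom // quotient1_isog.
case/homgP=> f im_f; case: formF => isoF [//|[_ /(_ gT G _ f)]].
by apply: isoF; rewrite /= im_f isog_refl.
Qed.

Lemma formation_quotient (gT : finGroupType) (G N : {group gT}) :
  F G -> N <| G -> F (G / N)%G.
Proof.
by move=> FG nNG; apply: formation_homg FG; apply: quotient_homg (normal_norm nNG).
Qed.

Lemma formation_quotientS (gT : finGroupType) (G A B : {group gT}) :
  A <| G -> B <| G -> A \subset B -> F (G / A)%G -> F (G / B)%G.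
Proof.
move=> nAG nBG sAB; apply: formation_homg.
by apply: homg_quotientS; rewrite ?normal_norm.
Qed.

Lemma formation_residualP (gT : finGroupType) (G N : {group gT}) :
  class_nonempty F -> N <| G -> residual F G \subset N -> F (G / N)%G.
Proof.
move=> neF nNG sRN.
by apply: formation_quotientS sRN (formation_residual _ _); rewrite ?residual_normal.
Qed.

Lemma formation_quotientI (gT : finGroupType) (G A B : {group gT}) :
  A <| G -> B <| G -> F (G / A)%G -> F (G / B)%G -> F (G / (A :&: B))%G.
Proof.
move=> nAG nBG FA FB; apply: formation_residualP; first by exists _, (G / A)%G.
  by rewrite normalI.
by rewrite subsetI !residual_sub.
Qed.

Lemma formation_subdirect (gT : finGroupType) (G A B : {group gT}) :
    A <| G -> B <| G -> A :&: B = 1 -> F (G / A)%G -> F (G / B)%G -> F G.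
Proof.
move=> nAG nBG AB1 FA FB; have:= formation_quotientI nAG nBG FA FB.
by apply: formation_isog; rewrite /= AB1 isog_sym quotient1_isog.
Qed.

End Formations.

(** By finiteness, closure under quotients by intersections of two normal subgroups puts
    [G / residual F G] itself into [F]; closure under images does the rest. *)
Lemma formation_intro (F : group_class) :
    (forall gT : finGroupType, F gT 1%G) ->
    (forall (gT rT : finGroupType) (G : {group gT}) (H : {group rT}),
       H \homg G -> F gT G -> F rT H) ->
    (forall (gT : finGroupType) (G A B : {group gT}),
       A <| G -> B <| G -> F _ (G / A)%G -> F _ (G / B)%G ->
       F _ (G / (A :&: B))%G) ->
  formation F.
Proof.
move=> F1 homF capF.
have trivF (rT : finGroupType) (H : {group rT}) : H :=: 1 -> F rT H.
  by move=> H1; apply: homF (F1 rT); rewrite H1 homg_refl.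
split=> [gT rT G H isoGH|].
  by apply: homF; rewrite isog_hom // isog_sym.
right; split=> // gT G rT phi.
apply: (homF _ _ (G / residual F G)%G); first exact: morphim_homg.
(* The induction over the big intersection carries [G :&: X], since the empty intersection is the
   whole ambient group. *)
have [N [eqN nNG FGN]]: exists N : {group gT},
    [/\ N :=: G :&: residual F G, N <| G & F _ (G / N)%G].
  rewrite /=; apply: (big_ind (fun X : {set gT} => exists N : {group gT},
    [/\ N :=: G :&: X, N <| G & F _ (G / N)%G])).
  - exists G; split; rewrite ?setIT //.
    by apply: trivF; apply: trivg_quotient.
  - move=> A B [N1 [e1 n1 f1]] [N2 [e2 n2 f2]]; exists (N1 :&: N2)%G.
    by split; [rewrite /= e1 e2 setIACA setIid | apply: normalI | apply: capF].
  move=> N /andP[nNG /asboolP FGN]; exists N; split=> //.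
  by apply/esym/setIidPr/normal_sub.
have sRG: residual F G \subset G.
  by apply: residual_sub => //; apply: (trivF _ (G / G)%G); apply: trivg_quotient.
have {}eqN: residual F G = N by apply/val_inj; rewrite /= eqN (setIidPr sRG).
by rewrite eqN.
Qed.

(** * The subgroup O_{p',p}(G) and the Frattini subgroup *)

Lemma pgroup_quotient_elt (gT : finGroupType) p (R N : {group gT}) :
    (forall x, x \in R -> p^'.-elt x -> x \in N) -> p.-group (R / N).
Proof.
move=> p'R; apply/pgroupP => q q_pr qR; apply: contraLR isT => p'q.
have [xb Rxb oxb] := Cauchy q_pr qR.
have [x nx Rx defx] := morphimP Rxb.
have p'xb: p^'.-elt xb by rewrite /p_elt oxb pnatE.
(* The lift [x] need not be a $p'$-element, but its $p'$-part has the same image [xb]. *)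
have: coset N x.`_p^' = 1.
  apply: coset_id; apply: p'R (p_elt_constt _ _).
  by apply: subsetP (cycle_constt _ x); rewrite cycle_subG.
rewrite morph_constt // -defx constt_p_elt // => x1.
by rewrite -oxb x1 order1 in q_pr.
Qed.

Lemma p_elt_p'_elt_eq1 (gT : finGroupType) (pi : nat_pred) (x : gT) :
  pi.-elt x -> pi^'.-elt x -> x = 1.
Proof. by move=> px p'x; rewrite -(constt_p_elt px); apply/constt1P. Qed.

Lemma mulg_Hall (gT : finGroupType) pi (L N S : {group gT}) :
  N <| L -> pi.-group (L / N) -> pi.-Hall(L) S -> N * S = L.
Proof.
move=> nNL piL hallS; have sSN := subset_trans (pHall_sub hallS) (normal_norm nNL).
rewrite -quotientK //; have: pi.-Hall(L / N) (S / N) by rewrite quotient_pHall.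
by move/pHall_id=> ->; rewrite // quotientGK.
Qed.

Lemma homg_morphim_quotient (aT rT : finGroupType) (D G A : {group aT})
    (f : {morphism D >-> rT}) (B : {group rT}) :
    G \subset D -> A <| G -> f @* G \subset 'N(B) -> f @* A \subset B ->
  f @* G / B \homg G / A.
Proof.
move=> sGD nAG nB sAB.
apply: (@homg_trans _ (f @* G / f @* A)).
  apply: homg_quotientS => //.
  by apply: subset_trans (morphim_norm _ _); rewrite morphimS ?normal_norm.
pose g := restrm_morphism sGD f.
have sAG := normal_sub nAG.
have im_g (C : {group aT}) : C \subset G -> g @* C = f @* C.
  by move=> sCG; rewrite morphim_restrm (setIidPr sCG).
rewrite -(im_g G) // -(im_g A) // -(morphim_quotm g nAG) morphim_homg //.
Qed.

Lemma normal_cosetpre_quotient (gT : finGroupType) (G N : {group gT})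
    (X : {group coset_of N}) :
  N <| G -> X <| G / N -> coset N @*^-1 X <| G.
Proof. by move=> nNG nXG; rewrite -(quotientGK nNG) cosetpre_normal. Qed.

Lemma quotient_quotient_isog (gT : finGroupType) (G N : {group gT})
    (X : {group coset_of N}) :
  N <| G -> X <| G / N -> G / N / X \isog G / (coset N @*^-1 X).
Proof.
move=> nNG nXG; rewrite -[X in _ / X \isog _]cosetpreK; apply: third_isog => //.
  exact: sub_cosetpre.
exact: normal_cosetpre_quotient.
Qed.

(** * The $p',p$-core modulo the Frattini subgroup *)

Section PNilpotent.

Implicit Types (gT : finGroupType) (p : nat).

Lemma p'p_core_max gT p (G N Y : {group gT}) :
    N <| G -> Y <| G -> p^'.-group Y -> p.-group (N / Y) ->
  N \subset 'O_{p^', p}(G).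
Proof.
move=> nNG nYG p'Y pNY; set O := 'O_p^'(G).
have sYO: Y \subset O by rewrite pcore_max.
have nON: N \subset 'N(O).
  by apply: subset_trans (normal_sub nNG) (gFnorm _ _).
rewrite -(quotientSGK nON) ?quotient_pseries2 /=; last first.
  by rewrite /O -pseries1 (pseries_sub_catl [:: _] [:: _]).
rewrite /O pcore_max ?quotient_normal //.
have nYN := subset_trans (normal_sub nNG) (normal_norm nYG).
by apply: pnat_dvd pNY; apply/card_homg/homg_quotientS.
Qed.

Lemma p'p_core_pgroup gT p (G : {group gT}) :
  p.-group ('O_{p^', p}(G) / 'O_p^'(G)).
Proof. by rewrite quotient_pseries2 pcore_pgroup. Qed.

Lemma p'_core_sub_p'p_core gT p (G : {group gT}) :
  'O_p^'(G) \subset 'O_{p^', p}(G).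
Proof. by rewrite -pseries1 (pseries_sub_catl [:: _] [:: _]). Qed.

Lemma Phi_mul_id gT (G H : {group gT}) : 'Phi(G) * H = G -> H :=: G.
Proof.
move=> defG; rewrite -[RHS](Phi_nongen (G := G) (X := H)) ?genGid //.
have sHG : H \subset G by rewrite -defG mulG_subr.
by rewrite norm_joinEr // (subset_trans sHG) ?gFnorm.
Qed.

Lemma Phi_Hall_normal gT pi (G L S : {group gT}) :
    solvable G -> L <| G -> 'Phi(G) \subset L -> pi.-group (L / 'Phi(G)) ->
    pi.-Hall(L) S ->
  S <| G /\ 'Phi(G) * S = L.
Proof.
move=> solG nLG sPL piL hallS; have sSL := pHall_sub hallS.
have nPL: 'Phi(G) <| L := normalS sPL (normal_sub nLG) (Phi_normal G).
have defL : 'Phi(G) * S = L by apply: mulg_Hall hallS.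
split=> //; have solL := solvableS (normal_sub nLG) solG.
have:= Hall_Frattini_arg solL nLG hallS.
rewrite -defL -mulgA (mulSGid (_ : S \subset 'N_G(S))); last first.
  by rewrite subsetI normG (subset_trans sSL (normal_sub nLG)).
move/Phi_mul_id => /= defG; rewrite /normal (subset_trans sSL (normal_sub nLG)) /=.
by apply/setIidPl.
Qed.

(** Otherwise a Sylow $p$-subgroup of $\Phi(G)$ is a normal Sylow subgroup of $G$. Its
    Schur-Zassenhaus complement generates $G$ together with $\Phi(G)$, so it is all of $G$. *)
Lemma dvdn_quotient_Phi gT p (G : {group gT}) :
  solvable G -> prime p -> p %| #|G| -> p %| #|G / 'Phi(G)|.
Proof.
move=> solG p_pr pG; apply: contraLR isT => p'Q.
have p'grQ : p^'.-group (G / 'Phi(G)) by rewrite /pgroup p'natE.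
have [P sylP] := Hall_exists p (solvableS (Phi_sub G) solG).
have sPP := pHall_sub sylP.
have nPG: P <| G.
  have:= Hall_Frattini_arg (solvableS (Phi_sub G) solG) (Phi_normal G) sylP.
  move/Phi_mul_id => /= defG; rewrite /normal (subset_trans sPP (Phi_sub G)) /=.
  by apply/setIidPl.
have hallP: p.-Hall(G) P.
  rewrite /pHall (normal_sub nPG) (pHall_pgroup sylP) /=.
  rewrite -(Lagrange_index (Phi_sub G) sPP) pnatM.
  rewrite -(card_quotient (gFnorm _ _)).
  by apply/andP; split; last by case/and3P: sylP.
have [K] := splitsP (SchurZassenhaus_split (pHall_Hall hallP) nPG).
case/complP => tiPK defG.
have: 'Phi(G) * K = G.
  apply/eqP; rewrite eqEsubset -{3}defG mulSg // andbT.
  by rewrite mul_subG ?gFsub // -defG mulG_subr.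
move/Phi_mul_id=> eK.
have P1: P :=: 1 by rewrite -tiPK eK; apply/esym/setIidPl/normal_sub.
move/card_Hall: hallP; rewrite P1 cards1 => /esym/eqP; rewrite partG_eq1.
by rewrite /pgroup p'natE // pG.
Qed.

(** This makes local classes saturated. A Hall $p'$-subgroup [S] of the preimage [L] of
    $O_{p'}(G/\Phi(G))$ is normal in $G$, and $|X:L|$ and $|L:S|$ are powers of $p$. *)
Lemma p'p_core_quotient_Phi gT p (G : {group gT}) : solvable G ->
  (coset 'Phi(G) @*^-1 'O_{p^', p}(G / 'Phi(G)))%G \subset 'O_{p^', p}(G).
Proof.
move=> solG; pose Q := (G / 'Phi(G))%G; have nPG := Phi_normal G.
set X := (coset 'Phi(G) @*^-1 'O_{p^', p}(Q))%G; set L := (coset 'Phi(G) @*^-1 'O_p^'(Q))%G.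
have sPL: 'Phi(G) \subset L by apply: sub_cosetpre.
have sLX: L \subset X by apply: morphpreS; apply: p'_core_sub_p'p_core.
have nXG: X <| G.
  by rewrite -(quotientGK nPG) cosetpre_normal pseries_normal.
have nLG: L <| G.
  by rewrite -(quotientGK nPG) cosetpre_normal pcore_normal.
have p'L: p^'.-group (L / 'Phi(G)) by rewrite cosetpreK pcore_pgroup.
have [S hallS] := Hall_exists p^' (solvableS (normal_sub nLG) solG).
have [nSG _] := Phi_Hall_normal solG nLG sPL p'L hallS.
have sSL := pHall_sub hallS.
apply: (p'p_core_max (N := X) nXG nSG).
  exact: pHall_pgroup hallS.
have nSX: X \subset 'N(S) := subset_trans (normal_sub nXG) (normal_norm nSG).
rewrite /pgroup card_quotient // -(Lagrange_index sLX sSL) pnatM.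
case/and3P: hallS => _ _; rewrite (eq_pnat _ (negnK _)) => -> /=; rewrite andbT.
rewrite -(card_quotient (subset_trans (normal_sub nXG) (normal_norm nLG))).
have nLX: L <| X := normalS sLX (normal_sub nXG) nLG.
have nPX: 'Phi(G) <| X by apply: normalS (normal_sub nXG) nPG; apply: sub_cosetpre.
have := p'p_core_pgroup p Q.
by rewrite /pgroup -(card_isog (third_isog sPL nPX nLX)) /X /L /= !cosetpreK.
Qed.

End PNilpotent.

(** * Locally defined classes *)

(* Agrees with [LF f] only on soluble groups, see [LF_local]. *)
Definition local_class (f : nat -> group_class) : group_class := fun gT G =>
  forall p, prime p -> p %| #|G| -> f p _ (G / 'O_{p^', p}(G))%G.

Section LocalClass.

Variable f : nat -> group_class.
Hypothesis formf : forall p, prime p -> formation (f p).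

Lemma local_class_homg (gT rT : finGroupType) (G : {group gT}) (H : {group rT}) :
  H \homg G -> local_class f G -> local_class f H.
Proof.
case/homgP=> phi im_phi locG p p_pr pH.
have pG: p %| #|G| by rewrite (dvdn_trans pH) // -im_phi dvdn_morphim.
apply: (formation_homg (formf p_pr) _ (locG p p_pr pG)).
have := @homg_morphim_quotient _ _ _ G ('O_{p^', p}(G))%G phi ('O_{p^', p}(H))%G.
rewrite im_phi; apply; rewrite ?pseries_normal ?gFnorm //.
by have:= morphim_pseries [:: negn p; p : nat_pred] G phi; rewrite im_phi.
Qed.

(** With $O = O_{p',p}(G)$, the group $H/(H\cap O)$ embeds in $G/O$, and $H\cap O$ lies in
    $O_{p',p}(H)$. *)
Lemma local_classS (gT : finGroupType) (G H : {group gT}) :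
    (forall p, prime p -> forall K : {group coset_of 'O_{p^', p}(G)},
       K \subset G / 'O_{p^', p}(G) -> f p (G / 'O_{p^', p}(G))%G -> f p K) ->
  H \subset G -> local_class f G -> local_class f H.
Proof.
move=> hered sHG locG p p_pr pH; set O := 'O_{p^', p}(G).
have fHO: f p (H / O)%G.
  by apply: hered; rewrite ?quotientS //; apply: locG; rewrite ?(dvdn_trans pH) ?cardSg.
apply: (formation_homg (formf p_pr) _ fHO).
have nOH: H \subset 'N(O) := subset_trans sHG (gFnorm _ _).
apply: homg_trans (isog_hom (second_isog nOH)).
apply: homg_quotientS; [by rewrite normsI ?normG | exact: gFnorm |].
exact: (pseriesS [:: negn p; p : nat_pred] sHG).
Qed.

Lemma local_class_Phi (gT : finGroupType) (G : {group gT}) :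
  solvable G -> local_class f (G / 'Phi(G))%G -> local_class f G.
Proof.
move=> solG locG p p_pr pG.
have pQ := dvdn_quotient_Phi solG p_pr pG.
have:= locG p p_pr pQ; set X := ('O_{p^', p}(G / 'Phi(G)))%G => fX.
have sXO := p'p_core_quotient_Phi p solG.
have nXG: coset 'Phi(G) @*^-1 X <| G.
  by rewrite normal_cosetpre_quotient ?Phi_normal ?pseries_normal.
apply: (formation_quotientS (formf p_pr) nXG (pseries_normal _ _) sXO _).
apply: (formation_isog (formf p_pr) _ fX).
by apply: quotient_quotient_isog; rewrite ?Phi_normal ?pseries_normal.
Qed.

Lemma local_class1 (gT : finGroupType) (G : {group gT}) :
  G :=: 1 -> local_class f G.
Proof.
by move=> G1 p p_pr; rewrite G1 cards1 dvdn1 => /eqP p1; rewrite p1 in p_pr.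
Qed.

End LocalClass.

(* The product N_p h. As 'O_1(G) = 1, it is h itself for p = 1, a value used
   below when no prime is singled out. *)
Definition pcore_quotient_class (p : nat) (h : group_class) : group_class :=
  fun gT G => h _ (G / 'O_p(G))%G.

(** * The product of the $p$-groups with a formation *)

Section PCoreQuotient.

Variables (p : nat) (h : group_class).
Hypothesis formh : formation h.
Local Notation E := (pcore_quotient_class p h).

Lemma pcore_quotient_homg (gT rT : finGroupType) (G : {group gT}) (H : {group rT}) :
  H \homg G -> E G -> E H.
Proof.
case/homgP=> phi im_phi; apply: (formation_homg formh).
have := @homg_morphim_quotient _ _ _ G ('O_p(G))%G phi ('O_p(H))%G.
rewrite im_phi; apply; rewrite ?pcore_normal ?gFnorm //.
by have:= morphim_pcore p G phi; rewrite im_phi.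
Qed.

Lemma pcore_quotient_max (gT : finGroupType) (G N : {group gT}) :
  N <| G -> p.-group N -> h (G / N)%G -> E G.
Proof.
move=> nNG pN; apply: (formation_quotientS formh nNG (pcore_normal p G)).
exact: pcore_max.
Qed.

Lemma pcore_quotient_pre (gT : finGroupType) (G N : {group gT}) :
    N <| G -> E (G / N)%G ->
  exists X : {group gT}, [/\ N \subset X, X <| G, p.-group (X / N) & h (G / X)%G].
Proof.
move=> nNG; rewrite /pcore_quotient_class /=; set X := ('O_p(G / N))%G => hX.
exists (coset N @*^-1 X)%G; split.
- exact: sub_cosetpre.
- by rewrite normal_cosetpre_quotient ?pcore_normal.
- by rewrite cosetpreK pcore_pgroup.
apply: (formation_isog formh _ hX).
by apply: quotient_quotient_isog; rewrite ?pcore_normal.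
Qed.

(** The $p'$-elements of the residual [R] lie in the core of every maximal subgroup, hence in
    $\Phi(G)$. So $R\Phi(G) = \Phi(G)S$ with $S$ a normal $p$-subgroup of $G$, and modulo $O_p(G)$
    the residual falls into the Frattini subgroup, where saturation of [h] applies. *)
Lemma pcore_quotient_gcore (gT : finGroupType) (G : {group gT}) :
    class_nonempty h ->
    (forall (rT : finGroupType) (H : {group rT}),
       solvable H -> h (H / 'Phi(H))%G -> h H) ->
    solvable G ->
    (forall M : {group gT}, maximal M G -> E (G / gcore M G)%G) ->
  E G.
Proof.
move=> neh hPhi solG maxE; pose R := residual h G.
have nRG: R <| G := residual_normal formh G neh.
have p'R x : x \in R -> p^'.-elt x -> x \in 'Phi(G).
  move=> Rx p'x; apply/bigcapP => M maxM.
  (* The intersection defining $\Phi(G)$ also runs over $G$ itself. *)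
  have [-> | {}maxM] := predU1P maxM; first exact: subsetP (normal_sub nRG) x Rx.
  have nCG: gcore M G <| G by rewrite gcore_normal ?maxgroupp // proper_sub // (maxgroupp maxM).
  have [X [sCX nXG pX hX]] := pcore_quotient_pre nCG (maxE M maxM).
  have Xx: x \in X by apply: (subsetP (residual_sub nXG hX) x Rx).
  have nCx: x \in 'N(gcore M G).
    by apply: (subsetP (normal_norm nCG) x _); apply: (subsetP (normal_sub nXG) x Xx).
  apply: (subsetP (gcore_sub M G) x _); apply: coset_idr => //.
  have: p.-elt (coset (gcore M G) x) by apply: mem_p_elt pX _; apply: mem_quotient.
  by move/constt_p_elt => <-; apply/constt1P; apply: morph_p_elt.
have nPhi := Phi_normal G.
pose L := (R <*> 'Phi(G))%G.
have nLG: L <| G by apply: normalY.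
have pL: p.-group (L / 'Phi(G)).
  rewrite /= quotientYidr ?(subset_trans (normal_sub nRG)) ?gFnorm //.
  exact: pgroup_quotient_elt p'R.
have [S sylS] := Hall_exists p (solvableS (normal_sub nLG) solG).
have [nSG defL] := Phi_Hall_normal solG nLG (joing_subr _ _) pL sylS.
have sSO: S \subset 'O_p(G) by rewrite pcore_max // (pHall_pgroup sylS).
apply: hPhi; first exact: quotient_sol.
set Y := (G / 'O_p(G))%G.
pose W := (coset 'O_p(G) @*^-1 'Phi(Y))%G.
have nWG: W <| G.
  by rewrite normal_cosetpre_quotient ?pcore_normal ?Phi_normal.
have sRW: R \subset W.
  apply: subset_trans (joing_subl R 'Phi(G)) _; rewrite -/(gval L) -defL.
  rewrite mul_subG ?(subset_trans sSO) ?sub_cosetpre //.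
  rewrite -sub_quotient_pre; last by rewrite (subset_trans (Phi_sub G)) ?gFnorm.
  have nOG: G \subset 'N('O_p(G)) := gFnorm _ _.
  exact: (@morphimF Frattini_gFun _ _ G _ (coset_morphism 'O_p(G)) nOG).
have:= formation_residualP formh neh nWG sRW.
apply: (formation_isog formh); rewrite isog_sym.
by apply: quotient_quotient_isog; rewrite ?pcore_normal ?Phi_normal.
Qed.

End PCoreQuotient.

(** * Centralisers of chief factors *)

(** With $C = C_G(F(G))$, the subgroup $F(C)$ is central in the preimage [K] of $F(C/F(C))$, so [K]
    is nilpotent and lies in $F(C)$. Thus the soluble group $C/F(C)$ has trivial Fitting subgroup
    and is trivial. *)
Lemma cent_sub_Fitting (gT : finGroupType) (G : {group gT}) :
  solvable G -> 'C_G('F(G)) \subset 'F(G).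
Proof.
move=> solG; pose C := 'C_G('F(G))%G.
have nCG: C <| G by rewrite /normal subsetIl normsI ?normG // norms_cent ?gFnorm.
have solC: solvable C := solvableS (normal_sub nCG) solG.
have nFC: 'F(C) <| G := gFnormal_trans _ nCG.
have sFC: 'F(C) \subset 'F(G) by rewrite Fitting_max ?Fitting_nil.
suffices: C \subset 'F(C) by move=> sC; apply: subset_trans sFC.
rewrite -quotient_sub1 ?gFnorm //; apply/trivgP/eqP.
rewrite -trivg_Fitting ?quotient_sol //.
pose K := (coset 'F(C) @*^-1 'F(C / 'F(C)))%G.
have nKC: K <| C by rewrite normal_cosetpre_quotient ?Fitting_normal.
have sFK: 'F(C) \subset K by apply: sub_cosetpre.
have sFZ: 'F(C) \subset 'Z(K).
  rewrite subsetI sFK centsC (subset_trans (normal_sub nKC)) //.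
  by rewrite (subset_trans (subsetIr _ _)) // centS.
have nilK: nilpotent K.
  rewrite -quotient_center_nil.
  have /homgP[f <-]: K / 'Z(K) \homg K / 'F(C).
    apply: homg_quotientS; rewrite ?gFnorm //.
    by apply: subset_trans (normal_sub nKC) (gFnorm _ _).
  by rewrite morphim_nil // /K /= cosetpreK Fitting_nil.
have sKF: K \subset 'F(C) by rewrite Fitting_max.
rewrite -(cosetpreK 'F(C / 'F(C))) -[_ @*^-1 _]/(gval K) -subG1.
by rewrite quotient_sub1 // (subset_trans sKF) ?normG.
Qed.

Lemma coprime_central_extend (gT : finGroupType) (A Q R : {group gT}) :
    A \subset 'N(Q) -> Q <| R -> coprime #|R| #|A| -> solvable R ->
    Q \subset 'C(A) -> R / Q \subset 'C(A / Q) ->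
  R \subset 'C(A).
Proof.
move=> nQA nQR coRA solR cQA cRA.
have := coprime_quotient_cent (normal_sub nQR) nQA coRA solR.
rewrite (setIidPl cRA) => /esym/eqP; rewrite eqEsubset => /andP[+ _].
rewrite (quotientSGK (normal_norm nQR)) ?subsetI ?(normal_sub nQR) //.
by case/andP.
Qed.

Section ChiefFactors.

Variables (gT : finGroupType) (p : nat) (G : {group gT}).
Hypotheses (solG : solvable G) (p_pr : prime p).

Lemma chief_factor_normal (H K : {group gT}) : chief_factor G K H ->
  [/\ H <| G, K <| G, K \subset H & K <| H].
Proof.
case/andP=> maxK nHG; have /andP[ltKH nKG] := maxgroupp maxK.
have sKH := proper_sub ltKH.
have nKG': K <| G by rewrite /normal (subset_trans sKH (normal_sub nHG)).
by split=> //; apply: (normalS sKH (normal_sub nHG) nKG').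
Qed.

Lemma chief_factor_exists (H : {group gT}) : H <| G -> H :!=: 1 ->
  exists2 K : {group gT}, chief_factor G K H & #|K| < #|H|.
Proof.
move=> nHG ntH; have [V maxV]: {V : {group gT} | maxnormal V H G}.
  by apply: ex_maxgroup; exists 1%G; rewrite proper1G ntH norms1.
have /andP[ltVH nVG] := maxgroupp maxV.
by exists V; [apply/andP | apply: proper_card].
Qed.

Lemma chief_factor_dvd (H : {group gT}) : H <| G -> p %| #|H| ->
  exists H' K' : {group gT}, chief_factor G K' H' /\ p %| #|H' / K'|.
Proof.
have [m] := ubnP #|H|; elim: m H => // m IHm H leHm nHG pH.
have ntH: H :!=: 1.
  by apply: contraTneq pH => ->; rewrite cards1 dvdn1; case: eqP p_pr => // ->.
have [K chK ltKH] := chief_factor_exists nHG ntH.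
have [_ nKG sKH nKH] := chief_factor_normal chK.
have [pHK | p'HK] := boolP (p %| #|H / K|); first by exists H, K.
apply: (IHm K) => //; first exact: leq_trans ltKH _.
move: pH; rewrite -(Lagrange sKH) -card_quotient ?normal_norm // Euclid_dvdM //.
by rewrite (negPf p'HK) orbF.
Qed.

(** Modulo $O = O_{p'}(G)$, a $p'$-element of $Z$ acts trivially on the sections that a chief series
    cuts out of $P = O_p(G/O)$. By coprime action it centralises $P = F(G/O)$, hence lies in $P$ and
    is trivial; so $Z$ is a $p$-group modulo $O$. *)
Lemma chief_cent_sub_p'p_core (Z : {group gT}) : Z <| G ->
    (forall H K : {group gT}, chief_factor G K H -> p %| #|H / K| ->
       Z \subset 'C(H / K | 'Q)) ->
  Z \subset 'O_{p^', p}(G).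
Proof.
move=> nZG cZ; pose O := 'O_p^'(G)%G; pose P := 'O_p(G / O)%G.
apply: (p'p_core_max nZG (pcore_normal _ _) (pcore_pgroup _ _)).
apply: pgroup_quotient_elt => x Zx p'x; rewrite -/O.
have nOG: G \subset 'N(O) := gFnorm _ _.
have Gx: x \in G := subsetP (normal_sub nZG) x Zx.
have nOx: x \in 'N(O) := subsetP nOG x Gx.
pose A := <[coset O x]>%G.
have p'A: p^'.-group A by rewrite /pgroup -/(p_elt _ _) morph_p_elt.
have sAZ: A \subset Z / O by rewrite cycle_subG mem_quotient.
have sAG: A \subset G / O := subset_trans sAZ (quotientS _ (normal_sub nZG)).
have solP : solvable P by rewrite (solvableS (pcore_sub _ _)) ?quotient_sol.
(* Descent along chief factors [H / K]; the case [H = G] covers all of [P]. *)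
have cHP (H : {group gT}) : H <| G -> H / O :&: P \subset 'C(A).
  have [m] := ubnP #|H|; elim: m H => // m IHm H leHm nHG.
  have [H1 | ntH] := eqVneq H 1%G.
    by rewrite H1 quotient1 (setIidPl (sub1G _)) sub1G.
  have [K chK ltKH] := chief_factor_exists nHG ntH.
  have [_ nKG sKH nKH] := chief_factor_normal chK.
  have nOH : H \subset 'N(O) := subset_trans (normal_sub nHG) nOG.
  have nOK : K \subset 'N(O) := subset_trans (normal_sub nKG) nOG.
  have IHK := IHm K (leq_trans ltKH leHm) nKG.
  have nKOG: K / O <| G / O by rewrite quotient_normal.
  have nHOG: H / O <| G / O by rewrite quotient_normal.
  have nPG: P <| G / O by rewrite pcore_normal.
  have nRQ: (K / O :&: P) <| (H / O :&: P).
    apply: normalS (normalI nKOG nPG); first by rewrite setSI ?quotientS.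
    by rewrite subIset ?normal_sub.
  have [pHK | p'HK] := boolP (p %| #|H / K|).
    apply: (coprime_central_extend _ nRQ) => //.
    - by rewrite (subset_trans sAG) ?normal_norm ?normalI.
    - rewrite (pnat_coprime _ p'A) //.
      by apply: pgroupS (pcore_pgroup p (G / O)); apply: subsetIr.
    - exact: solvableS (subsetIr _ _) solP.
    have nQA : A \subset 'N(K / O :&: P).
      by rewrite (subset_trans sAG) ?normal_norm ?normalI.
    rewrite (quotient_cents2 (normal_norm nRQ) nQA) subsetI; apply/andP; split.
      apply: subset_trans (commgSS (subsetIl _ _) sAZ) _.
      have nOZ := subset_trans (normal_sub nZG) nOG.
      have nKZ := subset_trans (normal_sub nZG) (normal_norm nKG).
      rewrite -(quotientR nOH nOZ) quotientS // commGC.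
      by rewrite -(sub_astabQR nKZ (normal_norm nKH)) cZ.
    apply: subset_trans (commSg _ (subsetIr _ _)) _.
    by rewrite commg_subl (subset_trans sAG) ?normal_norm.
  (* Here the section of [P] is both a $p$-group and a $p'$-group, so [H] contributes nothing beyond
     [K]. *)
  apply: subset_trans IHK; rewrite subsetI subsetIr andbT.
  have nKR : H / O :&: P \subset 'N(K / O).
    exact: subset_trans (subsetIl _ _) (subset_trans (normal_sub nHOG) (normal_norm nKOG)).
  rewrite -quotient_sub1 //; apply/trivgP/card1_trivg.
  apply: (@pnat_1 p _).
    rewrite -/(pgroup _ _) quotient_pgroup //.
    by apply: pgroupS (subsetIr _ _) (pcore_pgroup _ _).
  have : p^'.-nat #|H / K| by rewrite p'natE.
  apply: pnat_dvd; apply: dvdn_trans (cardSg (quotientS _ (subsetIl _ _))) _.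
  apply: card_homg; apply: homg_morphim_quotient => //.
  by rewrite quotient_norms ?normal_norm.
have cPA: P \subset 'C(A).
  have := cHP G (normal_refl G); rewrite (setIidPr _) //; exact: pcore_sub.
have FP: 'F(G / O) = P by apply: Fitting_eq_pcore; rewrite trivg_pcore_quotient.
have sAP: A \subset P.
  have := cent_sub_Fitting (quotient_sol O solG); rewrite FP; apply: subset_trans.
  by rewrite subsetI sAG centsC.
have A1 : A :=: 1.
  apply/card1_trivg/(@pnat_1 p) => //; exact: pgroupS sAP (pcore_pgroup _ _).
by apply: coset_idr => //; apply/set1gP; rewrite -A1 cycle_id.
Qed.

(** The normal $p'$-subgroup [Y] centralises the $p$-group $H/K$ by coprimeness, so the fixed points
    of [X] are those of its Sylow subgroup [P]. They are nontrivial and normal in $G/K$, so they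
    fill the minimal normal subgroup $H/K$. *)
Lemma p'p_core_sub_chief_cent (H K : {group gT}) :
    chief_factor G K H -> p %| #|H / K| ->
  'O_{p^', p}(G) \subset 'C(H / K | 'Q).
Proof.
move=> chK pHK; have [nHG nKG sKH nKH] := chief_factor_normal chK.
have nKX: 'O_{p^', p}(G) \subset 'N(K).
  exact: subset_trans (pseries_sub _ _) (normal_norm nKG).
rewrite sub_astabQ nKX /=.
have minH := chief_factor_minnormal chK.
have solQ := quotient_sol K solG.
have nHQ: H / K <| G / K by rewrite quotient_normal.
have [_ ntH abH] := minnormal_solvable minH (normal_sub nHQ) solQ.
have pH: p.-group (H / K).
  have /is_abelemP[q q_pr /abelem_pgroup qH] := abH.
  by have /eqP-> := pgroupP qH p p_pr pHK.
set X := ('O_{p^', p}(G) / K)%G; pose Y := ('O_p^'(G) / K)%G.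
have nYQ : Y <| G / K by rewrite quotient_normal ?pcore_normal.
have nXQ : X <| G / K by rewrite quotient_normal ?pseries_normal.
have sYX : Y \subset X by rewrite quotientS ?p'_core_sub_p'p_core.
have p'Y : p^'.-group Y by rewrite quotient_pgroup ?pcore_pgroup.
have cYH: Y \subset 'C(H / K).
  apply/commG1P/trivgP.
  rewrite -(coprime_TIg (pnat_coprime pH p'Y)) subsetI.
  rewrite commg_subr commg_subl.
  rewrite (subset_trans (normal_sub nYQ) (normal_norm nHQ)).
  exact: subset_trans (normal_sub nHQ) (normal_norm nYQ).
have nYX := normalS sYX (normal_sub nXQ) nYQ.
have pXY : p.-group (X / Y).
  rewrite /pgroup; apply: pnat_dvd (p'p_core_pgroup p G); apply: card_homg.
  apply: homg_morphim_quotient => //.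
  - by apply: normalS (p'_core_sub_p'p_core p G) (pseries_sub _ _) (pcore_normal _ _).
  - exact: normal_norm.
have [P sylP] := Sylow_exists p X.
have defX := mulg_Hall nYX pXY sylP.
have sPX := pHall_sub sylP.
have nHP: P \subset 'N(H / K).
  exact: subset_trans sPX (subset_trans (normal_sub nXQ) (normal_norm nHQ)).
pose Q := ((H / K) <*> P)%G.
have pQ: p.-group Q.
  by rewrite /Q /= norm_joinEr // pgroupM pH (pHall_pgroup sylP).
have nHQ' : H / K <| Q by rewrite /normal joing_subl join_subG normG.
have ntC: 'C_(H / K)(P) != 1.
  apply: contra ntH => /eqP C1.
  apply/eqP/(TI_center_nil (pgroup_nil pQ) nHQ')/trivgP; rewrite -C1.
  rewrite setIS // subIset //; apply/orP; right.
  by rewrite centS // joing_subr.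
have defC: 'C_(H / K)(P) = 'C_(H / K)(X).
  apply/eqP; rewrite eqEsubset (setIS _ (centS sPX)) andbT subsetI subsetIl /=.
  rewrite -defX centM subsetI subsetIr andbT.
  by apply: subset_trans (subsetIl _ _) _; rewrite centsC.
have [_ minC] := mingroupP minH.
rewrite centsC; apply/setIidPl; apply: (minC 'C_(H / K)(X)%G); last exact: subsetIl.
apply/andP; split; first by rewrite /= -defC.
by rewrite normsI ?norms_cent ?normal_norm.
Qed.

End ChiefFactors.

Section LF.

Variable f : nat -> group_class.
Hypothesis formf : forall p, prime p -> formation (f p).

(** The $f(p)$-residual lies in the centraliser of every $p$-chief factor, hence in $O_{p',p}(G)$.
    Conversely, each $G/C_G(H/K)$ is a quotient of $G/O_{p',p}(G)$. *)
Lemma LF_local (gT : finGroupType) (G : {group gT}) :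
  solvable G -> LF f G <-> local_class f G.
Proof.
move=> solG.
have nCG (H K : {group gT}) : chief_factor G K H -> 'C_G(H / K | 'Q) <| G.
  case/chief_factor_normal => nHG nKG _ _.
  rewrite /normal subsetIl normsI ?normG //.
  by apply: subset_trans (astab_norm _ _); apply: actsQ; rewrite ?normal_norm.
split=> [[G1 | [ntG chG]] | locG].
- exact: local_class1.
- move=> p p_pr pG.
  have [H [K [chK pHK]]] := chief_factor_dvd p_pr (normal_refl G) pG.
  have nef: class_nonempty (f p) by eexists; eexists; exact: chG chK p_pr pHK.
  apply: (formation_residualP (formf p_pr) nef (pseries_normal _ _)).
  apply: (chief_cent_sub_p'p_core solG p_pr); first by apply: (residual_normal (formf p_pr)).
  move=> H' K' chK' pHK'; apply: subset_trans (subsetIr G _).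
  by apply: residual_sub; [apply: nCG | apply: chG p_pr _].
have [G1 | ntG] := eqVneq (G : {set gT}) 1; [by left | right; split=> // H K p chK p_pr pHK].
have [nHG nKG sKH nKH] := chief_factor_normal chK.
have pG: p %| #|G|.
  by rewrite (dvdn_trans pHK) // (dvdn_trans (dvdn_quotient _ _)) // cardSg ?normal_sub.
apply: (formation_quotientS (formf p_pr) (pseries_normal _ _) _ _ (locG p p_pr pG)).
  exact: nCG.
by rewrite subsetI pseries_sub p'p_core_sub_chief_cent.
Qed.

End LF.

(** * Supplements of nilpotent normal subgroups *)

Section CosetPairs.

Variable gT : finGroupType.
Implicit Types (A B : {group gT}).

(** The pairs $(zx, x)$ with $z\in B$ and $x\in A$. For $A = G$ and $B = N$ normal this is the fibre
    product of two copies of $G$ over $G/N$. *)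
Definition coset_pairs (A B : {set gT}) : {set gT * gT} :=
  [set x | (x.2 \in A) && (x.1 * x.2^-1 \in B)].

Lemma coset_pairsP (A B : {set gT}) x :
  reflect (x.2 \in A /\ exists2 z, z \in B & x.1 = z * x.2) (x \in coset_pairs A B).
Proof.
rewrite inE; apply: (iffP andP) => [[Ax Bx]|[Ax [z Bz ->]]].
  by split=> //; exists (x.1 * x.2^-1); rewrite ?mulgKV.
by rewrite mulgK.
Qed.

Lemma coset_pairs_group_set A B : A \subset 'N(B) -> group_set (coset_pairs A B).
Proof.
move=> nBA; apply/group_setP; split; first by rewrite inE /= invg1 mulg1 !group1.
move=> [a b] [a' b'] /coset_pairsP[/= Ab [z Bz ->]] /coset_pairsP[/= Ab' [z' Bz' ->]].
apply/coset_pairsP; split; first exact: groupM.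
exists (z * z' ^ b^-1).
  by rewrite groupM // memJ_norm // (subsetP nBA) // groupV.
by rewrite /= conjgE invgK !mulgA mulgKV.
Qed.

Lemma coset_pairs_norm A B A' B' :
    A' \subset 'N(A) -> A' \subset 'N(B) -> B' \subset 'N(B) -> A \subset 'N(B) ->
    [~: A, B'] \subset B ->
  coset_pairs A' B' \subset 'N(coset_pairs A B).
Proof.
move=> nAA' nBA' nBB' nBA sAB'; apply/subsetP=> -[d c] /coset_pairsP[/= A'c [w B'w ->]].
rewrite inE; apply/subsetP=> _ /imsetP[[a b] /coset_pairsP[/= Ab [z Bz ->]] ->].
apply/coset_pairsP; split=> /=; first by rewrite memJ_norm ?(subsetP nAA').
(* This comes from $b^w = [w, b^{-1}] b$, whose commutator lies in [B] by the last hypothesis. *)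
exists ((z ^ w * [~ w, b^-1]) ^ c).
  rewrite memJ_norm ?(subsetP nBA') // groupM //.
    by rewrite memJ_norm ?(subsetP nBB').
  by rewrite (subsetP sAB') // commGC mem_commg ?groupV.
rewrite -[LHS]/((z * b) ^ (w * c)) -conjMg conjgM -mulgA (conjMg z); congr ((_ * _) ^ c).
by rewrite commgEl conjgE invgK !mulgA mulgKV -mulgA -conjgE.
Qed.

End CosetPairs.

Section LowerCentral.

Variables (gT : finGroupType) (N : {group gT}).

(** The three subgroups lemma in $N/L_{i+3}(N)$, where $[L_{i+1}(N), N, N]$ vanishes. *)
Lemma lcn_comm2 i : [~: 'L_i.+1(N), 'L_2(N)] \subset 'L_i.+3(N).
Proof.
pose L := 'L_i.+3(N)%G; have nL n : 'L_n(N) \subset 'N(L).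
  by rewrite (subset_trans (lcn_sub _ _)) ?lcn_norm.
have nLN : N \subset 'N(L) := lcn_norm _ _.
rewrite -quotient_sub1 ?comm_subG // quotientR // commGC.
rewrite lcn2 derg1 quotientR //; apply/trivgP.
have t1: [~: 'L_i.+1(N) / L, N / L, N / L] = 1.
  by rewrite -!quotientR // ?comm_subG // -!lcnSn trivg_quotient.
apply: three_subgroup; last exact: t1.
by rewrite (commGC (N / L) ('L_i.+1(N) / L)).
Qed.

(** If $L_{c+2}(N) = 1$, the case $i = c$ puts $L_{c+1}(M)$ into the diagonal copy of $L_{c+1}(N)$;
    factoring that copy out lowers the class. *)
Lemma lcn_coset_pairs (M : {group gT * gT}) i :
    M \subset coset_pairs N 'L_2(N) ->
  'L_i.+1(M) \subset coset_pairs 'L_i.+1(N) 'L_i.+2(N).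
Proof.
move=> sM; have gM j : group_set (coset_pairs 'L_j.+1(N) 'L_j.+2(N)).
  by rewrite coset_pairs_group_set // (subset_trans (lcn_sub _ _)) ?lcn_norm.
elim: i => [|i IHi]; first by rewrite lcn1.
rewrite lcnSn; apply: subset_trans (commgSS IHi sM) _.
rewrite (gen_subG _ (Group (gM i.+1))).
apply/subsetP=> x /imset2P[[a b] [d c] /coset_pairsP[/= Lb [z Lz ->]]].
move=> /coset_pairsP[/= Nc [w Lw ->]] -> {x}.
apply/coset_pairsP; split=> /=; first by rewrite lcnSn mem_commg.
(* Modulo [L], the element [z] commutes with all of [N], and [b] commutes with [w] by [lcn_comm2];
   hence the two commutators agree. *)
pose L := 'L_i.+3(N)%G; exists ([~ z * b, w * c] * [~ b, c]^-1); last by rewrite mulgKV.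
have Nx n x : x \in 'L_n(N) -> x \in 'N(L).
  by apply: subsetP; rewrite (subset_trans (lcn_sub _ _)) ?lcn_norm.
have nb := Nx _ _ Lb; have nz := Nx _ _ Lz; have nw := Nx _ _ Lw.
have nc: c \in 'N(L) := subsetP (lcn_norm _ N) c Nc.
have comm_coset x y : x \in 'N(L) -> y \in 'N(L) -> [~ x, y] \in L ->
    commute (coset L x) (coset L y).
  move=> nx ny Lxy; apply/commgP/eqP.
  by rewrite -(coset_id Lxy); apply/esym/(morphR (coset_morphism L)).
have cz y : y \in N -> commute (coset L z) (coset L y).
  move=> Ny; apply: comm_coset => //; first exact: subsetP (lcn_norm _ N) y Ny.
  by rewrite /L /= lcnSn mem_commg.
have cbw: commute (coset L b) (coset L w).
  by apply: comm_coset => //; apply: subsetP (lcn_comm2 i) _ _; apply: mem_commg.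
have Nw : w \in N by apply: subsetP (lcn_sub _ _) _ Lw.
apply: coset_idr; first by rewrite groupM ?groupV ?groupR ?groupM.
rewrite morphM ?groupV ?groupR ?groupM // morphV ?groupR // !morphR ?groupM //.
rewrite !morphM // commMgJ (_ : [~ coset L z, _] = 1); last first.
  by apply/eqP/commgP; apply: commuteM; apply: cz.
rewrite conj1g mul1g commgMJ (_ : [~ coset L b, coset L w] = 1); last exact/eqP/commgP.
by rewrite conj1g mulg1 mulgV.
Qed.

End LowerCentral.

Section BryantBryceHartley.

Variable F : group_class.
Hypothesis formF : formation F.

(* Induction on the class c of N, with Z its last nontrivial lower central term.
   In the fibre product D of two copies of G over G / N, the pairs (zn, n) with
   z in N' form a normal subgroup which, modulo the diagonal copy of Z, has
   smaller class and is supplemented by X = {(zu, u) : z in N, u in U}. So X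
   modulo the diagonal of Z lies in F; as X projects onto G with a kernel that
   avoids the diagonal, X lies in F, and U is a quotient of X. *)
Lemma formation_nilpotent_supplement c (gT : finGroupType) (G N U : {group gT}) :
  N <| G -> N * U = G -> 'L_c.+1(N) = 1 -> F G -> F U.
Proof.
elim: c gT G N U => [|c IHc] gT G N U nNG defG LN1 FG.
  suff <- : G = U by [].
  by apply/group_inj; rewrite -defG (_ : gval N = 1) ?mul1g -?LN1 ?lcn1.
have sUG: U \subset G by rewrite -defG mulG_subr.
have nNU := subset_trans sUG (normal_norm nNG).
pose Z := 'L_c.+1(N)%G; have nZG: Z <| G := char_normal_trans (lcn_char _ _) nNG.
have sZN: Z \subset N := lcn_sub _ _.
have cZN: [~: Z, N] \subset [1 gT] by rewrite -lcnSn LN1.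
have gD: group_set (coset_pairs G N) by rewrite coset_pairs_group_set ?normal_norm.
have gZ: group_set (coset_pairs Z [1 gT]) by rewrite coset_pairs_group_set ?norms1.
have gM: group_set (coset_pairs N 'L_2(N)) by rewrite coset_pairs_group_set ?lcn_norm.
have gX: group_set (coset_pairs U N) by rewrite coset_pairs_group_set.
pose D := Group gD; pose Zd := Group gZ; pose M := Group gM; pose X := Group gX.
have sZD: Zd \subset D.
  apply/subsetP=> x /coset_pairsP[Zx [z /set1gP-> ex]]; apply/coset_pairsP.
  by split; [apply: subsetP (normal_sub nZG) _ Zx | exists 1].
have sXD: X \subset D.
  apply/subsetP=> x /coset_pairsP[Zx [z Nz ex]]; apply/coset_pairsP.
  by split; [apply: subsetP sUG _ Zx | exists z].
have sMD: M \subset D.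
  apply/subsetP=> x /coset_pairsP[Nx [z Nz ex]]; apply/coset_pairsP.
  split; first exact: subsetP (normal_sub nNG) _ Nx.
  by exists z => //; apply: subsetP (lcn_sub _ _) _ Nz.
have nZD: Zd <| D.
  rewrite /normal sZD; apply: coset_pairs_norm; rewrite ?norms1 //.
  exact: normal_norm nZG.
have nLG: 'L_2(N) <| G := char_normal_trans (lcn_char _ _) nNG.
have nMD: M <| D.
  rewrite /normal sMD; apply: coset_pairs_norm; rewrite ?lcn_norm //.
    exact: normal_norm nNG.
  exact: normal_norm nLG.
have subNG := subsetP (normal_sub nNG).
have defD: M * X = D.
  apply/eqP; rewrite eqEsubset mul_subG //=.
  apply/subsetP=> -[a b] /coset_pairsP[/= Gb [z Nz ->]].
  move: Gb; rewrite -defG => /mulsgP[n u Nn Uu ->].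
  have -> : (z * (n * u), n * u) = (n, n) * (z ^ n * u, u).
    by congr pair; rewrite /= conjgE !mulgA mulgV mul1g.
  apply: mem_mulg; apply/coset_pairsP; split=> //.
    by exists 1; rewrite ?mul1g.
  by exists (z ^ n); rewrite // groupJ.
(* As $L_{c+2}(N) = 1$, the pairs in question are diagonal, so [M / Zd] has class at most [c]. *)
have LM: 'L_c.+1(M) \subset Zd.
  by have := @lcn_coset_pairs _ N M c (subxx _); rewrite LN1.
pose f1 := @fst_morphism gT gT; pose f2 := @snd_morphism gT gT.
have isoker (f : {morphism [set: gT * gT] >-> gT}) (H : {group gT * gT}) (K : {group gT}) :
    f @* H = K -> 'ker_H f <| H /\ (K \isog H / 'ker_H f).
  move=> <-; split; first exact: normalGI (subsetT H) (ker_normal f).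
  by rewrite isog_sym first_isog_loc ?subsetT.
have f1D : f1 @* D = G.
  apply/setP=> a; apply/morphimP/idP=> [[[x y] _ /coset_pairsP[/= Gy [z Nz ex]] ->] | Ga].
    by rewrite /= ex groupM // subNG.
  by exists (a, a); rewrite ?inE //=; rewrite mulgV Ga group1.
have f2D : f2 @* D = G.
  apply/setP=> a; apply/morphimP/idP=> [[[x y] _ /coset_pairsP[/= Gy _] ->] | Ga] //.
  by exists (a, a); rewrite ?inE //=; rewrite mulgV Ga group1.
have f1X : f1 @* X = G.
  apply/setP=> a; apply/morphimP/idP=> [[[x y] _ /coset_pairsP[/= Uy [z Nz ex]] ->] | ].
    by rewrite /= ex (groupM (subNG z Nz)) // (subsetP sUG).
  rewrite -defG => /mulsgP[n u Nn Uu ->].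
  by exists (n * u, u); rewrite ?inE //= mulgK Uu Nn.
have f2X : f2 @* X = U.
  apply/setP=> a; apply/morphimP/idP=> [[[x y] _ /coset_pairsP[/= Gy _] ->] | Ua] //.
  by exists (a, a); rewrite ?inE //=; rewrite mulgV Ua group1.
have FD: F D.
  have [nk1 iso1] := isoker f1 D G f1D; have [nk2 iso2] := isoker f2 D G f2D.
  apply: (formation_subdirect formF nk1 nk2); last 2 first.
  - exact: (formation_isog formF iso1 FG).
  - exact: (formation_isog formF iso2 FG).
  apply/trivgP/subsetP=> -[a b] /setIP[/setIP[_ /(kerP _ (in_setT _))/= ->]].
  by move=> /setIP[_ /(kerP _ (in_setT _))/= ->]; apply/set1gP.
have FXZ: F (X / Zd)%G.
  apply: (IHc _ (D / Zd)%G (M / Zd)%G); rewrite ?quotient_normal //.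
  - by rewrite -quotientMl ?(subset_trans sMD (normal_norm nZD)) // defD.
  - have nZM := subset_trans sMD (normal_norm nZD).
    apply: etrans (esym (morphim_lcn (coset_morphism Zd) c.+1 nZM)) _.
    by apply/trivgP; rewrite quotient_sub1 // (subset_trans (lcn_sub _ _)).
  - exact: formation_quotient.
have FX: F X.
  have [nk1 iso1] := isoker f1 X G f1X.
  have nZX := subset_trans sXD (normal_norm nZD).
  have nk2 : (Zd :&: X)%G <| X by rewrite /= setIC; apply: normalGI sXD nZD.
  apply: (formation_subdirect formF nk1 nk2); last 2 first.
  - exact: (formation_isog formF iso1 FG).
  - apply: (formation_isog formF _ FXZ); rewrite isog_sym; exact: second_isog.
  apply/trivgP/subsetP=> -[a b] /setIP[/setIP[_ /(kerP _ (in_setT _))/= ->]].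
  by case/setIP=> /coset_pairsP[/= _ [z /set1gP->]]; rewrite mul1g => <- _; apply/set1gP.
by apply: (formation_homg formF _ FX); rewrite -f2X morphim_homg.
Qed.

End BryantBryceHartley.

(** * Fitting height *)

Definition trivial_groups : group_class := fun gT G => G :=: 1.

Lemma trivial_groups_formation : formation trivial_groups.
Proof.
apply: formation_intro => [gT | gT rT G H /card_homg dvd G1 | gT G A B nAG nBG].
- by [].
- by move: dvd; rewrite G1 cards1 dvdn1 => /eqP/card1_trivg.
rewrite /trivial_groups => /= GA GB; apply/trivgP.
have sG (N : {group gT}) : N <| G -> G / N = 1 -> G \subset N.
  by move=> /andP[_ nNG] GN; rewrite -quotient_sub1 // GN.
have nI := normal_norm (normalI nAG nBG).
by rewrite quotient_sub1 // subsetI !sG.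
Qed.

Lemma p'_elt_p'p_core (gT : finGroupType) (p : nat) (G : {group gT}) x :
  x \in 'O_{p^', p}(G) -> p^'.-elt x -> x \in 'O_p^'(G).
Proof.
move=> Ox p'x; have Gx : x \in G by apply: subsetP (pseries_sub _ _) x Ox.
have nx : x \in 'N('O_p^'(G)) by apply: subsetP (gFnorm _ _) x Gx.
apply: coset_idr => //.
have: p.-elt (coset 'O_p^'(G) x).
  by apply: (mem_p_elt (p'p_core_pgroup p G)); apply: mem_quotient.
by move/constt_p_elt => <-; apply/constt1P; apply: morph_p_elt.
Qed.

(** A $p'$-element of [X N] lies in [Y N], and a $p$-element of [Y N] lies in [N]. Both facts
    survive intersection over [A] and [B], which yields closure of local classes under subdirect
    products. *)
Lemma cosetpre_p'p_core_quotientI (gT : finGroupType) (p : nat) (G A B : {group gT}) :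
    A <| G -> B <| G ->
  (coset A @*^-1 'O_{p^', p}(G / A) :&: coset B @*^-1 'O_{p^', p}(G / B))
    / (A :&: B) \subset 'O_{p^', p}(G / (A :&: B)).
Proof.
move=> nAG nBG; pose D := (A :&: B)%G; have nDG : D <| G := normalI nAG nBG.
pose X (N : {group gT}) := (coset N @*^-1 'O_{p^', p}(G / N))%G.
pose Y (N : {group gT}) := (coset N @*^-1 'O_p^'(G / N))%G.
have nXG (N : {group gT}) : N <| G -> X N <| G.
  by move=> nNG; rewrite normal_cosetpre_quotient ?pseries_normal.
have nYG (N : {group gT}) : N <| G -> Y N <| G.
  by move=> nNG; rewrite normal_cosetpre_quotient ?pcore_normal.
have nX := normalI (nXG A nAG) (nXG B nBG); have nY := normalI (nYG A nAG) (nYG B nBG).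
have Xp' (N : {group gT}) x : N <| G -> x \in X N -> p^'.-elt x -> x \in Y N.
  move=> nNG Xx p'x; have Gx := subsetP (normal_sub (nXG N nNG)) x Xx.
  have nNx := subsetP (normal_norm nNG) x Gx.
  case/morphpreP: Xx => _ Xx; apply/morphpreP; split=> //.
  by apply: p'_elt_p'p_core => //; apply: morph_p_elt.
have Yp (N : {group gT}) x : N <| G -> x \in Y N -> p^'^'.-elt x -> x \in N.
  move=> nNG Yx px; have Gx := subsetP (normal_sub (nYG N nNG)) x Yx.
  have nNx := subsetP (normal_norm nNG) x Gx.
  case/morphpreP: Yx => _ Yx; apply: coset_idr => //.
  apply: (@p_elt_p'_elt_eq1 _ p^'); last exact: morph_p_elt.
  exact: mem_p_elt (pcore_pgroup _ _) Yx.
apply: (@p'p_core_max _ _ _ ((X A :&: X B) / D)%G ((Y A :&: Y B) / D)%G).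
- exact: quotient_normal.
- exact: quotient_normal.
- apply: pgroup_quotient_elt => x /setIP[YAx YBx] px.
  by apply/setIP; split; apply: Yp.
apply: pgroup_quotient_elt => _ /morphimP[x nx /setIP[XAx XBx] ->] p'x.
(* The lift is replaced by its $p'$-part, which has the same image. *)
rewrite -(constt_p_elt p'x) -morph_constt // mem_quotient // inE.
have mem_constt (H : {group gT}) : x \in H -> x.`_p^' \in H.
  by move=> Hx; apply: subsetP (cycle_constt _ x); rewrite cycle_subG.
by apply/andP; split; apply: Xp'; rewrite ?p_elt_constt ?mem_constt.
Qed.

Lemma local_class_formation (f : nat -> group_class) :
    (forall p, prime p -> formation (f p)) ->
    (forall p, prime p -> class_nonempty (f p)) ->
  formation (local_class f).
Proof.
move=> formf nef; apply: formation_intro => [gT | gT rT G H | gT G A B nAG nBG lA lB].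
- exact: local_class1.
- exact: local_class_homg.
move=> p p_pr pG; have formp := formf p p_pr.
have nDG := normalI nAG nBG.
pose X (N : {group gT}) := (coset N @*^-1 'O_{p^', p}(G / N))%G.
have nXG (N : {group gT}) : N <| G -> X N <| G.
  by move=> nNG; rewrite normal_cosetpre_quotient ?pseries_normal.
have fX (N : {group gT}) : N <| G -> local_class f (G / N)%G -> f p _ (G / X N)%G.
  move=> nNG lN; apply: (formation_isog formp (G := (G / N / 'O_{p^', p}(G / N))%G)).
    by apply: quotient_quotient_isog; rewrite ?pseries_normal.
  (* If $p$ does not divide $|G/N|$ the local condition is vacuous, but then $G/N$ is a $p'$-group
     and [G / X N] is trivial. *)
  have [pGN | p'GN] := boolP (p %| #|G / N|); first exact: lN.
  have [hT [H fH]] := nef p p_pr; apply: (formation1 formp fH) => /=.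
  suffices -> : 'O_{p^', p}(G / N) = G / N by rewrite trivg_quotient.
  apply/eqP; rewrite eqEsubset pseries_sub /=.
  apply: subset_trans (p'_core_sub_p'p_core _ _).
  by rewrite pcore_max // /pgroup p'natE.
have fXX := formation_quotientI formp (nXG A nAG) (nXG B nBG) (fX A nAG lA) (fX B nBG lB).
have nXX := normalI (nXG A nAG) (nXG B nBG).
have sDX : A :&: B \subset X A :&: X B by rewrite setISS ?sub_cosetpre.
apply: (formation_homg formp _ fXX).
apply: homg_trans (isog_hom (third_isog sDX nDG nXX)).
apply: homg_quotientS; [|exact: gFnorm | exact: cosetpre_p'p_core_quotientI].
by apply: quotient_norms; apply: normal_norm.
Qed.

(** The constant local definition of $\mathcal N^s$; in this form it can be intersected prime by
    prime with another local definition. *)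
Fixpoint fitting_height_le (s : nat) : group_class :=
  if s is s'.+1 then local_class (fun _ => fitting_height_le s') else trivial_groups.

Lemma fitting_height_le_formation s : formation (fitting_height_le s).
Proof.
(* Trivial groups are carried along to keep the values non-empty. *)
suff: formation (fitting_height_le s) /\
    forall gT : finGroupType, fitting_height_le s (1%G : {group gT}).
  by case.
elim: s => [|s [IHs triv]]; first by split=> //; apply: trivial_groups_formation.
split; last by move=> gT; apply: local_class1.
apply: local_class_formation => // p _.
by exists {perm bool}, 1%G; apply: triv.
Qed.

Lemma Fitting_sub_p'p_core (gT : finGroupType) (p : nat) (G : {group gT}) :
  'F(G) \subset 'O_{p^', p}(G).
Proof.
apply: (@p'p_core_max _ _ _ 'F(G)%G ('O_p^'('F(G)))%G); rewrite ?pcore_pgroup ?gFnormal_trans //.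
apply: pgroup_quotient_elt => x Fx p'x.
by rewrite (mem_normal_Hall (nilpotent_pcore_Hall _ (Fitting_nil G)) (pcore_normal _ _)).
Qed.

Lemma fitting_height_le_Fitting s (gT : finGroupType) (G : {group gT}) :
  fitting_height_le s (G / 'F(G))%G -> fitting_height_le s.+1 G.
Proof.
move=> hs p p_pr _; apply: (formation_quotientS (fitting_height_le_formation s) _ _ _ hs).
- exact: Fitting_normal.
- exact: pseries_normal.
exact: Fitting_sub_p'p_core.
Qed.

(** * The ascending Fitting series *)

Section UpperFitting.

Variables (gT : finGroupType) (G : {group gT}).
Hypothesis solG : solvable G.
Local Notation U i := (upper_fitting_at i G).

Lemma upper_fitting_normal i : U i <| G.
Proof.
elim: i => [|i IHi]; first exact: normal1.
by rewrite /= normal_cosetpre_quotient ?Fitting_normal.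
Qed.

Lemma upper_fitting_subS i : U i \subset U i.+1.
Proof. exact: sub_cosetpre. Qed.

(** Strict growth brings the series to $G$ by index $|G|-1$, the last one listed in
    [nilpotent_length], so the search there succeeds. *)
Lemma upper_fitting_card i : U i = G \/ i < #|U i|.
Proof.
elim: i => [|i [eqG | IHi]]; first by right; rewrite cards1.
  left; apply/group_inj/eqP; rewrite eqEsubset (normal_sub (upper_fitting_normal i.+1)).
  by rewrite -{1}eqG upper_fitting_subS.
have [eqG | neG] := eqVneq (U i.+1) G; [by left | right].
apply: leq_ltn_trans IHi (proper_card _); rewrite properE upper_fitting_subS /=.
apply: contra neG => sUS; have nUG := upper_fitting_normal i.
have F1 : 'F(G / U i) = 1.
  rewrite -(cosetpreK 'F(G / U i)); apply/trivgP.
  by rewrite quotient_sub1 // (subset_trans sUS) ?normG.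
have /eqP GU1 : G / U i == 1 by rewrite -trivg_Fitting ?quotient_sol //; apply/eqP.
have sGU: G \subset U i by rewrite -quotient_sub1 ?normal_norm // GU1.
apply/eqP/group_inj/eqP; rewrite eqEsubset (normal_sub (upper_fitting_normal i.+1)).
exact: subset_trans sGU (upper_fitting_subS i).
Qed.

Lemma upper_fitting_nilpotent_length s : nilpotent_length G <= s -> U s = G.
Proof.
pose t := mkseq (fun i => U i) #|G|; have Gt: G \in t.
  apply/mapP; exists #|G|.-1; first by rewrite mem_iota add0n prednK ?cardG_gt0 /=.
  have [//|] := upper_fitting_card #|G|.-1; rewrite prednK ?cardG_gt0 // => leGU.
  by apply/esym/group_inj/eqP; rewrite eqEcard normal_sub ?upper_fitting_normal.
have lt_t: index G t < #|G| by rewrite -[X in _ < X](size_mkseq (fun i => U i)) index_mem.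
have := nth_index G Gt; rewrite nth_mkseq // -/(nilpotent_length G).
move: (nilpotent_length G) => n Un; elim: s => [|s IHs].
  by rewrite leqn0 => /eqP n0; rewrite n0 in Un.
rewrite leq_eqVlt ltnS => /predU1P[<- // | /IHs UsG].
apply/group_inj/eqP; rewrite eqEsubset (normal_sub (upper_fitting_normal s.+1)).
by rewrite -{1}UsG upper_fitting_subS.
Qed.

Lemma nilpotent_length_fitting_height s :
  nilpotent_length G <= s -> fitting_height_le s G.
Proof.
move/upper_fitting_nilpotent_length=> UsG.
(* Descending the series from $G = F_s(G)$, each step adds one nilpotent layer to the quotient. *)
suffices hj j : j <= s -> fitting_height_le j (G / U (s - j))%G.
  have := hj s (leqnn s); rewrite subnn.
  apply: formation_isog (fitting_height_le_formation s) _ _ _ _ _.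
  by rewrite isog_sym quotient1_isog.
elim: j => [|j IHj] lt_js.
  by rewrite subn0 UsG; apply: trivg_quotient.
apply: fitting_height_le_Fitting.
have := IHj (ltnW lt_js); rewrite -(subnSK lt_js).
apply: (formation_isog (fitting_height_le_formation j)).
rewrite isog_sym; apply: quotient_quotient_isog; first exact: upper_fitting_normal.
exact: Fitting_normal.
Qed.

End UpperFitting.

(** The local condition makes every $G/O_{p'}(G)$ a $p$-group, and the $O_{p'}(G)$ for $p\in\pi(G)$
    intersect trivially. *)
Lemma fitting_height_le1 (gT : finGroupType) (G : {group gT}) :
  fitting_height_le 1 G <-> nilpotent G.
Proof.
split=> [loc1 | nilG]; last first.
  apply: fitting_height_le_Fitting; rewrite /= /trivial_groups /=.
  by rewrite nilpotent_Fitting ?trivg_quotient.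
(* The index [#|G|.+1] serves all these quotients at once, whatever their classes. *)
have nilQ p : p \in \pi(G) -> 'L_#|G|.+1(G) \subset 'O_p^'(G).
  move=> pG; have p_pr : prime p by move: pG; rewrite mem_primes => /andP[].
  have pdG : p %| #|G| by move: pG; rewrite mem_primes => /and3P[].
  have /= G1 := loc1 p p_pr pdG.
  have sG: G \subset 'O_{p^', p}(G).
    by rewrite -quotient_sub1 ?gFnorm //; apply/trivgP.
  have pQ: p.-group (G / 'O_p^'(G)).
    by apply: pgroupS (p'p_core_pgroup p G); apply: quotientS.
  have nilQ := pgroup_nil pQ.
  rewrite -quotient_sub1; last first.
    by apply: subset_trans (lcn_sub _ _) (gFnorm _ _).
  have -> : 'L_#|G|.+1(G) / 'O_p^'(G) = 'L_#|G|.+1(G / 'O_p^'(G)).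
    exact: (morphim_lcn (coset_morphism _) _ (gFnorm _ _)).
  apply/trivgP/lcn_nil_classP => //.
  by move: nilQ; rewrite nilpotent_class => /ltnW/leq_trans; apply; apply: leq_quotient.
apply/lcnP; exists #|G|; apply/trivgP.
have -> : [1 gT] = 'O_(\pi(G))^'(G).
  apply/esym/card1_trivg; apply: pnat_1 (pcore_pgroup _ _).
  exact: pgroupS (pcore_sub _ _) (pgroup_pi G).
rewrite -bigcap_p'core subsetI lcn_sub; apply/bigcapsP => p /nilQ; exact.
Qed.

(** * Multiply saturated formations *)

Definition class_inter (E F : group_class) : group_class :=
  fun gT G => E gT G /\ F gT G.

Lemma class_inter_formation (E F : group_class) :
  formation E -> formation F -> formation (class_inter E F).
Proof.
move=> formE formF.
have [neEF | emEF] := pselect (class_nonempty (class_inter E F)); last first.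
  split; last by left.
  move=> gT rT G H isoGH [EG FG].
  by split; [apply: (formation_isog formE isoGH) | apply: (formation_isog formF isoGH)].
have [gT [G [EG FG]]] := neEF.
apply: formation_intro => [rT | aT rT A B homBA [EA FA] | rT H A B nAH nBH [EA FA] [EB FB]].
- by split; [apply: (formation1 formE EG) | apply: (formation1 formF FG)].
- by split; [apply: (formation_homg formE homBA) | apply: (formation_homg formF homBA)].
by split; apply: formation_quotientI.
Qed.

(** Multiple saturation as seen on soluble groups, with nilpotent groups at the bottom: the form on
    which the inductions for subgroup closure and for critical groups run. *)
Fixpoint iterated_local (r : nat) (F : group_class) : Prop :=
  formation F /\
  if r is r'.+1 then
    exists g : nat -> group_class,
      [/\ forall p, prime p -> formation (g p),
          forall (gT : finGroupType) (G : {group gT}),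
            solvable G -> (F gT G <-> local_class g G)
        & forall p, prime p -> class_nonempty (g p) -> iterated_local r' (g p)]
  else class_sub F nilpotent_groups.

Lemma iterated_local_formation r F : iterated_local r F -> formation F.
Proof. by case: r => [|r] []. Qed.

(* Intersecting f(p) with the groups of Fitting height at most r does not change
   LF(f), because the centraliser of a chief factor contains the Fitting
   subgroup. *)
Lemma multiply_saturated_iterated_local r F :
  multiply_saturated r F -> iterated_local r (class_inter F (fitting_height_le r.+1)).
Proof.
elim: r F => [|r IHr] F.
  move=> /= formF; split.
    exact: class_inter_formation (fitting_height_le_formation 1).
  by move=> gT G [_ /fitting_height_le1].
case=> formF [f [formf eqF satf]]; split.
  exact: class_inter_formation (fitting_height_le_formation r.+2).
exists (fun p => class_inter (f p) (fitting_height_le r.+1)); split.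
- move=> p p_pr; apply: class_inter_formation (fitting_height_le_formation r.+1).
  exact: formf.
- move=> gT G solG; split=> [[/eqF/(LF_local formf solG) lG hG] p p_pr pG | lG].
    by split; [apply: lG | apply: hG].
  split; last by move=> p p_pr pG; case: (lG p p_pr pG).
  by apply/eqF/(LF_local formf solG) => p p_pr pG; case: (lG p p_pr pG).
move=> p p_pr [gT [G [fG _]]]; apply: IHr; apply: satf => //.
by exists gT, G.
Qed.

(** Every subgroup supplements the nilpotent normal subgroup $N = G$. *)
Lemma formation_nilpotentS (F : group_class) (gT : finGroupType) (G H : {group gT}) :
  formation F -> nilpotent G -> H \subset G -> F gT G -> F gT H.
Proof.
move=> formF /lcnP[c LG] sHG.
by apply: (formation_nilpotent_supplement formF (normal_refl G) _ LG); rewrite mulGSid.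
Qed.

Lemma iterated_localS r F (gT : finGroupType) (G H : {group gT}) :
  iterated_local r F -> solvable G -> H \subset G -> F gT G -> F gT H.
Proof.
elim: r F gT G H => [|r IHr] F gT G H.
  by case=> formF nilF solG sHG FG; apply: (formation_nilpotentS formF (nilF _ _ FG)).
case=> formF [g [formg locF itg]] solG sHG /(locF _ _ solG) lG.
apply/(locF _ _ (solvableS sHG solG)); apply: (local_classS formg _ sHG lG).
move=> p p_pr K sK gG; apply: (IHr _ _ _ _ _ _ sK gG) => //.
  by apply: itg => //; exists _, (G / 'O_{p^', p}(G))%G.
exact: quotient_sol.
Qed.

(** * Critical groups *)

Local Notation pquo := pcore_quotient_class.

Definition maximals_in (h : group_class) : group_class :=
  fun gT G => forall M : {group gT}, maximal M G -> h gT M.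

Lemma pcore_quotient_trivial (p : nat) (h : group_class) (gT : finGroupType) (G : {group gT}) :
  formation h -> 'O_p(G) = 1 -> pquo p h G <-> h gT G.
Proof.
move=> formh O1; have iso: G \isog (G / 'O_p(G))%G by rewrite /= O1 quotient1_isog.
by split; apply: (formation_isog formh); rewrite // isog_sym.
Qed.

Lemma pcore_notin_pi (p : nat) (gT : finGroupType) (G : {group gT}) :
  p \notin primes #|G| -> 'O_p(G) = 1.
Proof.
move=> p'G; apply/card1_trivg/(@pnat_1 p); first exact: pcore_pgroup.
by apply: pgroupS (pcore_sub _ _) _; rewrite p'groupEpi.
Qed.

Lemma count_primes_leS (a b : pred nat) (q m n : nat) :
    (forall l, l \in primes m -> a l -> l = q \/ (l \in primes n /\ b l)) ->
  count a (primes m) <= (count b (primes n)).+1.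
Proof.
move=> ab; rewrite -!size_filter.
apply: (@uniq_leq_size _ _ (q :: [seq l <- primes n | b l])).
  by rewrite filter_uniq ?primes_uniq.
move=> l; rewrite mem_filter inE => /andP[al /ab[//|-> | [nl bl]]].
  by rewrite eqxx.
by rewrite mem_filter nl bl orbT.
Qed.

Lemma maximals_in_quotient (h : group_class) (gT : finGroupType) (G N : {group gT}) :
  (forall (rT : finGroupType) (K : {group gT}) (H : {group rT}), H \homg K -> h _ K -> h _ H) ->
  N <| G -> maximals_in h G -> maximals_in h (G / N)%G.
Proof.
move=> homh nNG maxh Mb maxM.
have sMG : Mb \subset G / N by rewrite proper_sub ?(maxgroupp maxM).
have [M defM sNM sMG'] := inv_quotientS nNG sMG.
apply: (homh _ M); first by rewrite defM quotient_homg ?(subset_trans sMG') ?normal_norm.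
apply: maxh; rewrite -(quotient_maximal _ nNG) ?(normalS sNM sMG' nNG) //.
by rewrite -defM.
Qed.

Lemma mulg_maximal_normal (gT : finGroupType) (G M N : {group gT}) :
  maximal M G -> N <| G -> ~~ (N \subset M) -> N * M = G.
Proof.
move=> maxM nNG sNM; have sMG := proper_sub (maxgroupp maxM).
have nNM := subset_trans sMG (normal_norm nNG).
rewrite -norm_joinEr //; have /maximal_eqP[_ maxMG] : maximal_eq M G.
  by rewrite /maximal_eq maxM orbT.
have [||eqM | //] := maxMG (N <*> M)%G; first exact: joing_subr.
  by rewrite join_subG normal_sub.
by case/negP: sNM; rewrite -eqM joing_subl.
Qed.

(** * Primitive soluble groups *)

Section PrimitiveSoluble.

Variables (gT : finGroupType) (P T V : {group gT}).
Hypotheses (solP : solvable P) (maxT : maximal T P) (coreT : gcore T P = 1).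
Hypothesis minV : minnormal V P.
Hypothesis sVP : V \subset P.

Lemma primitive_minnormal_normal : V <| P.
Proof. by rewrite /normal sVP; case/andP: (mingroupp minV). Qed.
Let nVP := primitive_minnormal_normal.

Lemma primitive_mulg : V * T = P.
Proof.
apply: mulg_maximal_normal => //.
apply: contraL (mingroupp minV) => sVT; rewrite negb_and negbK -subG1.
by rewrite -coreT sub_gcore ?sVT // normal_norm.
Qed.

(** Both [T] and [V] normalise $T\cap C_P(V)$, which therefore lies in the trivial core of [T];
    Dedekind's law and $P = VT$ conclude. *)
Lemma primitive_cent_minnormal : 'C_P(V) = V.
Proof.
have [_ _ /is_abelemP[q q_pr /abelem_abelian abV]] := minnormal_solvable minV sVP solP.
have sVC : V \subset 'C_P(V) by rewrite subsetI sVP.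
have nCP: 'C_P(V) <| P by rewrite /normal subsetIl normsI ?normG ?norms_cent ?normal_norm.
have sCT: T :&: 'C_P(V) \subset gcore T P.
  apply: gcore_max; first exact: subsetIl.
  rewrite -{1}primitive_mulg mul_subG //.
    rewrite cents_norm // centsC; apply: subset_trans (subsetIr _ _) _.
    exact: subsetIr.
  rewrite normsI ?normG // (subset_trans _ (normal_norm nCP)) //.
  exact: proper_sub (maxgroupp maxT).
apply/eqP; rewrite eqEsubset sVC andbT.
have -> : 'C_P(V) = V * T :&: 'C_P(V) by rewrite primitive_mulg setIA setIid.
rewrite -group_modl // mul_subG //; apply: subset_trans sCT _.
by rewrite coreT sub1G.
Qed.

Variable q : nat.
Hypothesis qV : q.-group V.

(** By coprimeness [Y] centralises [V], hence lies in $C_P(V) = V$, a $q$-group. *)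
Lemma primitive_p'normal (W Y : {group gT}) :
  V \subset W -> W \subset P -> Y <| W -> q^'.-group Y -> Y :=: 1.
Proof.
move=> sVW sWP nYW q'Y.
have nVW : V <| W := normalS sVW sWP nVP.
have cYV: Y \subset 'C(V).
  apply/commG1P/trivgP; rewrite -(coprime_TIg (pnat_coprime qV q'Y)) subsetI.
  rewrite commg_subr commg_subl (subset_trans (normal_sub nYW) (normal_norm nVW)).
  exact: subset_trans sVW (normal_norm nYW).
have sYV: Y \subset V.
  by rewrite -primitive_cent_minnormal subsetI cYV (subset_trans (normal_sub nYW)).
by apply/card1_trivg/(pnat_1 _ q'Y); apply: pgroupS sYV qV.
Qed.

(** In the $q$-group [X], the subgroup $V\cap Z(X)$ is nontrivial, and it is normal in [P], so it
    equals [V]. Then $X\le C_P(V) = V$. *)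
Lemma primitive_normal_pgroup (X : {group gT}) :
  V \subset X -> X <| P -> q.-group X -> X :=: V.
Proof.
move=> sVX nXP qX; have /andP[ntV nPV] := mingroupp minV.
have nVX := normalS sVX (normal_sub nXP) nVP.
have ntVZ : V :&: 'Z(X) != 1.
  by apply: contra ntV => /eqP/(TI_center_nil (pgroup_nil qX) nVX) ->.
have nZP : 'Z(X) <| P := char_normal_trans (center_char X) nXP.
have [_ minV'] := mingroupP minV.
have eVZ : V :&: 'Z(X) = V.
  apply: (minV' (V :&: 'Z(X))%G); last exact: subsetIl.
  by rewrite ntVZ normsI ?normal_norm.
apply/eqP; rewrite eqEsubset sVX andbT -primitive_cent_minnormal subsetI normal_sub //=.
rewrite centsC -eVZ; apply: subset_trans (subsetIr _ _) _.
exact: subsetIr.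
Qed.

End PrimitiveSoluble.

(** * Critical primitive groups modulo their minimal normal subgroup *)

Section CriticalStep.

Variables (g : nat -> group_class) (h : group_class) (B : nat).
Hypothesis formg : forall p, prime p -> formation (g p).
Hypothesis formh : formation h.
Hypothesis hg : forall (gT : finGroupType) (G : {group gT}),
  solvable G -> (h G <-> local_class g G).
Hypothesis boundB : forall (q : nat) (gT : finGroupType) (G : {group gT}),
  prime q -> solvable G -> maximals_in (pquo q (g q)) G -> ~ pquo q (g q) G ->
  count (predC1 q) (primes #|G|) <= B.

(** The alternative is whether $P/V$ lies in $\mathcal N_q g(q)$. If not, it is critical for that
    product and [boundB] applies; if so, $P/V\in h$ would force $P\in h$. *)
Lemma critical_primitive (p : nat) (gT : finGroupType) (P T : {group gT}) :
    solvable P -> maximal T P -> gcore T P = 1 ->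
    maximals_in (pquo p h) P -> ~ pquo p h P ->
  exists (V : {group gT}) (q : nat),
    [/\ V <| P, V :!=: 1, prime q, q.-group V & q != p]
    /\ (count (predC1 q) (primes #|P / V|) <= B \/
        [/\ ~ h (P / V)%G, pquo p h (P / V)%G & maximals_in h (P / V)%G]).
Proof.
move=> solP maxT coreT maxE nEP.
have ltTP := maxgroupp maxT.
have ntP : P :!=: 1.
  by apply: contraTneq ltTP => ->; rewrite properE sub1G andbF.
have [V minV sVP] := minnormal_exists ntP (normG P).
have nVP := primitive_minnormal_normal minV sVP.
have defP := primitive_mulg maxT coreT minV sVP.
have [_ ntV /is_abelemP[q q_pr /abelem_pgroup qV]] := minnormal_solvable minV sVP solP.
exists V, q.
have EPV: pquo p h (P / V)%G.
  apply: (pcore_quotient_homg formh _ (maxE T maxT)).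
  rewrite /= -defP quotientMidl quotient_homg //.
  exact: subset_trans (proper_sub ltTP) (normal_norm nVP).
have pre_pgroup (l : nat) (X : {group gT}) :
    V \subset X -> X <| P -> l.-group (X / V) -> l.-group V -> l.-group X.
  move=> sVX nXP lXV lV; have nVX := subset_trans (normal_sub nXP) (normal_norm nVP).
  by rewrite /pgroup -(Lagrange sVX) pnatM -card_quotient //; apply/andP; split.
(* If $q = p$, the preimage of $O_p(P/V)$ is a $p$-group, and [P] itself lies in $\mathcal N_p
   h$. *)
have neqp : q != p.
  apply/eqP=> eqp; apply: nEP; have [X [sVX nXP pXV hX]] := pcore_quotient_pre formh nVP EPV.
  apply: (pcore_quotient_max formh nXP _ hX); apply: pre_pgroup => //.
  by rewrite -eqp.
have O1 (l : nat) (W : {group gT}) : l != q -> V \subset W -> W \subset P -> 'O_l(W) = 1.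
  move=> nlq sVW sWP.
  apply: (primitive_p'normal solP maxT coreT minV sVP qV sVW sWP (pcore_normal _ _)).
  by apply: pi_p'group (pcore_pgroup _ _) _; rewrite !inE eq_sym.
have Oq' (W : {group gT}) : V \subset W -> W \subset P -> 'O_q^'(W) = 1.
  move=> sVW sWP.
  apply: (primitive_p'normal solP maxT coreT minV sVP qV sVW sWP (pcore_normal _ _)).
  exact: pcore_pgroup.
have nhP : ~ h P.
  move=> hP; apply: nEP.
  by apply/(pcore_quotient_trivial formh (O1 p P _ sVP (subxx P))); rewrite // eq_sym.
split; first by split.
have maxW (M : {group coset_of V}) : maximal M (P / V) ->
    h M /\ pquo q (g q) M.
  move=> maxM; have sMP : M \subset P / V by rewrite proper_sub ?(maxgroupp maxM).
  have [W defM sVW sWP] := inv_quotientS nVP sMP.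
  have nVW := normalS sVW sWP nVP.
  have maxW : maximal W P by rewrite -(quotient_maximal nVW nVP) -defM.
  have hW : h W.
    by apply/(pcore_quotient_trivial formh (O1 p W _ sVW sWP)); [rewrite eq_sym | apply: maxE].
  have homMW : M \homg W by rewrite defM quotient_homg ?normal_norm.
  split; first exact: (formation_homg formh homMW hW).
  apply: (pcore_quotient_homg (formg q_pr) homMW).
  have qW : q %| #|W|.
    have := pgroup_pdiv qV ntV => -[_ qV' _]; exact: dvdn_trans qV' (cardSg sVW).
  have solW := solvableS sWP solP.
  (* Since $O_{q'}(W) = 1$, the subgroup $O_{q',q}(W)$ is a $q$-group, and the local condition at
     $q$ gives $W\in\mathcal N_q g(q)$. *)
  have := (hg solW).1 hW q q_pr qW.
  apply: (pcore_quotient_max (formg q_pr) (pseries_normal _ _)).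
  rewrite /pgroup; have := p'p_core_pgroup q W; rewrite /pgroup Oq' //.
  by rewrite -(card_isog (quotient1_isog _)).
have maxg : maximals_in (pquo q (g q)) (P / V)%G by move=> M /maxW[].
have maxh : maximals_in h (P / V)%G by move=> M /maxW[].
have [Eq | nEq] := pselect (pquo q (g q) (P / V)%G); [right | left]; last first.
  by apply: boundB => //; apply: quotient_sol.
split=> //; move=> hPV; apply: nhP; apply/(hg solP) => l l_pr lP.
have [X [sVX nXP qXV gX]] := pcore_quotient_pre (formg q_pr) nVP Eq.
have eXV : X = V.
  apply/group_inj; apply: (primitive_normal_pgroup solP maxT coreT minV sVP) => //.
  exact: pre_pgroup qXV qV.
(* At $q$, the equality $X = V$ puts $P/V$ into $g(q)$, with $V\le O_{q',q}(P)$. At $l\ne q$ the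
   $l'$-group $V$ is absorbed into $O_{l'}(P)$. *)
have [elq | nlq] := eqVneq l q.
  rewrite elq; rewrite eXV in gX.
  apply: (formation_quotientS (formg q_pr) nVP (pseries_normal _ _) _ gX).
  apply: (p'p_core_max nVP (normal1 P) (pgroup1 _ _)).
  by rewrite /pgroup -(card_isog (quotient1_isog _)).
have l'V : l^'.-group V by apply: (pi_p'group qV); rewrite !inE.
have lPV : l %| #|P / V|.
  move: lP; rewrite -(Lagrange sVP) -card_quotient ?normal_norm // Euclid_dvdM //.
  by case/orP=> // lV; move: l'V; rewrite /pgroup p'natE // lV.
have := (hg (quotient_sol V solP)).1 hPV l l_pr lPV.
pose N := (coset V @*^-1 'O_{l^', l}(P / V))%G.
pose Y := (coset V @*^-1 'O_l^'(P / V))%G.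
have nNP : N <| P by rewrite normal_cosetpre_quotient ?pseries_normal.
have nYP : Y <| P by rewrite normal_cosetpre_quotient ?pcore_normal.
have sVY : V \subset Y := sub_cosetpre _.
have sYN : Y \subset N by apply: morphpreS; apply: p'_core_sub_p'p_core.
have isoN : P / V / 'O_{l^', l}(P / V) \isog P / N.
  by apply: quotient_quotient_isog; rewrite ?pseries_normal.
move/(formation_isog (formg l_pr) (H := (P / N)%G) isoN).
apply: (formation_quotientS (formg l_pr) nNP (pseries_normal _ _)).
apply: (p'p_core_max nNP nYP).
  have nVY := subset_trans (normal_sub nYP) (normal_norm nVP).
  rewrite /pgroup -(Lagrange sVY) pnatM -card_quotient //; apply/andP; split=> //.
  by rewrite cosetpreK; apply: pcore_pgroup.
rewrite /pgroup -(card_isog (third_isog sVY _ _)) //.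
- by rewrite /N /Y /= !cosetpreK; apply: p'p_core_pgroup.
- exact: normalS (subset_trans sVY sYN) (normal_sub nNP) nVP.
- exact: normalS sYN (normal_sub nNP) nYP.
Qed.

End CriticalStep.

(** Here [p] may be any number: for $p = 1$ all primes are counted and the groups are critical for
    [h] itself. *)
Definition critical_bound (h : group_class) (B : nat) : Prop :=
  forall (p : nat) (gT : finGroupType) (G : {group gT}),
    solvable G -> maximals_in (pquo p h) G -> ~ pquo p h G ->
    count (predC1 p) (primes #|G|) <= B.

Lemma sub_Phi (gT : finGroupType) (G C : {group gT}) :
  C \subset G -> (forall M : {group gT}, maximal M G -> C \subset M) -> C \subset 'Phi(G).
Proof.
by move=> sCG sCM; apply/bigcapsP=> M /predU1P[-> | /sCM].
Qed.

Lemma quotient_mulg_homg (gT : finGroupType) (G N M : {group gT}) :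
  M \subset 'N(N) -> N * M = G -> G / N \homg M.
Proof. by move=> nNM <-; rewrite quotientMidl quotient_homg. Qed.

Lemma gcore_quotient_gcore (gT : finGroupType) (G M : {group gT}) :
  M \subset G -> gcore (M / gcore M G) (G / gcore M G) = 1.
Proof.
move=> sMG; pose C := gcore M G; have nCG : C <| G := gcore_normal sMG.
have nCM : C <| M := normalS (gcore_sub _ _) sMG nCG.
pose X := (coset C @*^-1 (gcore (M / C) (G / C)))%G.
have sXM : X \subset M.
  by rewrite -(quotientGK nCM); apply: morphpreS; apply: gcore_sub.
have nXG : X <| G.
  rewrite normal_cosetpre_quotient // gcore_normal //; exact: quotientS.
have sXC: X \subset C by rewrite sub_gcore // normal_norm.
rewrite -(cosetpreK (gcore (M / C) (G / C))); apply/trivgP.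
by rewrite quotient_sub1 // (subset_trans sXC) ?normG.
Qed.

(** Passing from [g] to [h] costs one prime, that of the minimal normal subgroup [V]. In the second
    alternative the smaller group [X] is critical for [h] and divisible by $p$; its bound counts
    $p$, and discarding $p$ pays for $q$. *)
Lemma critical_bound_local (g : nat -> group_class) (h : group_class) (B : nat) :
    (forall p, prime p -> formation (g p)) -> formation h ->
    (forall (gT : finGroupType) (G : {group gT}),
       solvable G -> (h gT G <-> local_class g G)) ->
    (forall q, prime q -> forall (gT : finGroupType) (G : {group gT}),
       solvable G -> maximals_in (pquo q (g q)) G -> ~ pquo q (g q) G ->
       count (predC1 q) (primes #|G|) <= B) ->
  critical_bound h B.+1.
Proof.
move=> formg formh hg boundB p gT G.
have [m] := ubnP #|G|; elim: m p gT G => // m IHm p gT G leGm solG maxE nEG.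
have hPhi (rT : finGroupType) (H : {group rT}) : solvable H -> h _ (H / 'Phi(H))%G -> h _ H.
  move=> solH /(hg _ _ (quotient_sol _ solH)) lH.
  by apply/(hg _ _ solH); apply: local_class_Phi.
have neh: class_nonempty h.
  by exists gT, 1%G; apply/(hg _ _ (solvable1 _)); apply: local_class1.
have [M maxM nEM]: exists2 M : {group gT}, maximal M G & ~ pquo p h (G / gcore M G)%G.
  apply: contrapT => noM; apply: nEG; apply: (pcore_quotient_gcore formh neh hPhi solG) => M maxM.
  by apply: contrapT => nE; apply: noM; exists M.
have sMG := proper_sub (maxgroupp maxM); have nCG := gcore_normal sMG.
have sCM : gcore M G \subset M := gcore_sub _ _.
(* A maximal subgroup not containing the core would map onto $G/\mathrm{core}$ and bring it into
   $\mathcal N_p h$. Being Frattini, the core can be factored out without losing a prime. *)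
have sCPhi : gcore M G \subset 'Phi(G).
  apply: sub_Phi => [|M' maxM']; first exact: subset_trans sCM sMG.
  apply/negPn/negP=> sCM'; apply: nEM; apply: (pcore_quotient_homg formh _ (maxE M' maxM')).
  apply: quotient_mulg_homg (mulg_maximal_normal maxM' nCG sCM').
  exact: subset_trans (proper_sub (maxgroupp maxM')) (normal_norm nCG).
have primesC l : prime l -> l %| #|G| -> l %| #|G / gcore M G|.
  move=> l_pr lG; apply: dvdn_trans (dvdn_quotient_Phi solG l_pr lG) _.
  by apply: card_homg; apply: homg_quotientS; rewrite ?gFnorm ?gcore_norm.
have nCM := normalS sCM sMG nCG.
have maxMC : maximal (M / gcore M G) (G / gcore M G) by rewrite quotient_maximal.
have maxEC : maximals_in (pquo p h) (G / gcore M G)%G.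
  apply: maximals_in_quotient => // rT K H homHK; exact: (pcore_quotient_homg formh).
have [V [q [[nVP ntV q_pr qV neqp] alt]]] :=
  critical_primitive formg formh hg (fun q gT G q_pr => boundB q q_pr gT G)
    (quotient_sol _ solG) maxMC (gcore_quotient_gcore sMG) maxEC nEM.
set X := (G / gcore M G / V)%G in alt.
have primesX l : l \in primes #|G| -> l = q \/ l \in primes #|X|.
  rewrite !mem_primes !cardG_gt0 /= => /andP[l_pr lG].
  have := primesC l l_pr lG; rewrite -(Lagrange (normal_sub nVP)).
  rewrite -card_quotient ?normal_norm // Euclid_dvdM // l_pr /=.
  by case/orP=> [lV | -> //]; [left; apply/eqP; exact: (pgroupP qV) | right].
case: alt => [leB | [nhX EX maxX]].
  apply: (@leq_trans (count (predC1 q) (primes #|X|)).+1); last by rewrite ltnS.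
  apply: (@count_primes_leS _ _ q) => l lG _.
  have [-> | nlq] := eqVneq l q; first by left.
  by case: (primesX l lG) => [/eqP | lX]; [rewrite (negPf nlq) | right].
(* Otherwise $O_p(X) = 1$, and $X\in\mathcal N_p h$ would mean $X\in h$. *)
have pX : p \in primes #|X|.
  apply/negPn/negP=> p'X; apply: nhX.
  by apply/(pcore_quotient_trivial formh (pcore_notin_pi p'X)).
have E1 (rT : finGroupType) (K : {group rT}) : pquo 1%N h K <-> h _ K.
  by apply: pcore_quotient_trivial => //; apply: pcore_notin_pi; rewrite mem_primes.
have ltXG : #|X| < m.
  apply: leq_trans (ltn_quotient ntV (normal_sub nVP)) _.
  by apply: leq_trans (leq_quotient _ _) _.
(* The induction hypothesis is used at 1 rather than [p]. *)
have := IHm 1%N _ X ltXG (quotient_sol _ (quotient_sol _ solG)).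
move=> /(_ (fun K maxK => (E1 _ K).2 (maxX K maxK)) (fun EX1 => nhX ((E1 _ X).1 EX1))).
have -> : count (predC1 1%N) (primes #|X|) = size (primes #|X|).
  apply/eqP; rewrite -all_count; apply/allP=> l; rewrite mem_primes => /andP[l_pr _].
  by rewrite /= neq_ltn prime_gt1 ?orbT.
rewrite -(count_predC (pred1 p)) count_uniq_mem ?primes_uniq // pX => leB.
apply: leq_trans leB; apply: (@count_primes_leS _ _ q) => l lG nlp.
by case: (primesX l lG); [left | right].
Qed.

(** * Bounds for the primes of critical groups *)

Lemma count_ge2 (T : eqType) (a : pred T) (s : seq T) :
  uniq s -> 1 < count a s -> exists x y, [/\ x != y, x \in s, y \in s, a x & a y].
Proof.
rewrite -size_filter => us; have := filter_uniq a us.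
case E: [seq x <- s | a x] => [|x [|y t]] //= /andP[+ _] _.
rewrite inE negb_or => /andP[nxy _]; exists x, y.
have : x \in [seq x <- s | a x] by rewrite E mem_head.
have : y \in [seq x <- s | a x] by rewrite E !inE eqxx orbT.
by rewrite !mem_filter => /andP[-> ->] /andP[-> ->].
Qed.

(** Given primes $a\ne b$ other than $q$, a Sylow $a$-subgroup is proper, so it lies in a maximal
    subgroup, which is a $q$-group. *)
Lemma critical_bound_trivial : critical_bound trivial_groups 1.
Proof.
move=> q gT G solG maxq nqG; rewrite leqNgt; apply/negP=> lt1.
have [a [b [neab aG bG naq nbq]]] := count_ge2 (primes_uniq _) lt1.
have [S sylS] := Sylow_exists a G; have sSG := pHall_sub sylS.
move: aG bG; rewrite !mem_primes => /and3P[a_pr _ aG] /and3P[b_pr _ bG].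
have ltS : S :!=: G.
  apply: contraTneq bG => <-; apply/negP => bS.
  by have /eqP eba := pgroupP (pHall_pgroup sylS) b b_pr bS; rewrite eba eqxx in neab.
have [eS | [M maxM sSM]] := maximal_exists sSG; first by rewrite eS eqxx in ltS.
have qM : q.-group M.
  have /= M1 := maxq M maxM; apply: pgroupS (pcore_pgroup q M).
  by rewrite -quotient_sub1 ?gFnorm //; apply/trivgP.
have aM : a %| #|M|.
  apply: dvdn_trans (cardSg sSM); rewrite (card_Hall sylS).
  by rewrite p_part dvdn_exp // logn_gt0 mem_primes a_pr aG cardG_gt0.
by have /eqP eaq := pgroupP qM a a_pr aM; rewrite /= eaq eqxx in naq.
Qed.

Lemma critical_bound_nilpotent : critical_bound (fitting_height_le 1) 2.
Proof.
apply: (@critical_bound_local (fun _ => trivial_groups)) => [p _|||q q_pr gT G].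
- exact: trivial_groups_formation.
- exact: fitting_height_le_formation.
- by move=> gT G _; split.
exact: critical_bound_trivial.
Qed.

(** With three primes other than $p$, the bound for nilpotent groups makes $K = G/O_p(G)$ nilpotent.
    Each $K/O_q(K)$ is an image of a maximal subgroup of $G$ and lies in [h]; two values of $q$
    exhibit $K$ as a subdirect product. *)
Lemma critical_bound_sub_nilpotent (h : group_class) :
  formation h -> class_sub h nilpotent_groups -> critical_bound h 2.
Proof.
move=> formh nilh p gT G solG maxE nEG; rewrite leqNgt; apply/negP=> lt2.
have maxN : maximals_in (pquo p (fitting_height_le 1)) G.
  by move=> M maxM; apply/fitting_height_le1; apply: nilh; apply: maxE.
have nilK : nilpotent (G / 'O_p(G)).
  apply/fitting_height_le1; apply: contrapT => nE.
  by have := critical_bound_nilpotent solG maxN nE; rewrite leqNgt lt2.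
pose K := (G / 'O_p(G))%G.
have [a [b [neab aG bG nap nbp]]] := count_ge2 (primes_uniq _) (ltnW lt2).
have p'K : p \notin primes #|K|.
  have O1 : 'O_p(K) = 1 by apply: trivg_pcore_quotient.
  have cO1 : #|'O_p(K)| = 1%N by rewrite O1 cards1.
  have /eqP := etrans (esym (card_Hall (nilpotent_pcore_Hall p nilK))) cO1.
  by rewrite partG_eq1 p'groupEpi.
have hquo q : q \in primes #|G| -> q != p -> h _ (K / 'O_q(K))%G.
  rewrite mem_primes => /and3P[q_pr _ qG] nqp.
  have qK : q %| #|K|.
    move: qG; rewrite -(Lagrange (pcore_sub p G)) -card_quotient ?gFnorm // Euclid_dvdM //.
    case/orP=> // qO; have /eqP eqp := pgroupP (pcore_pgroup p G) q q_pr qO.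
    by rewrite eqp eqxx in nqp.
  have [_ defK _ _] := dprodP (nilpotent_pcoreC q nilK).
  (* A maximal subgroup of [K] above $O_{q'}(K)$ supplements $O_q(K)$. *)
  have [eK | [Mb maxMb sOM]] := maximal_exists (pcore_sub q^' K).
    have : q^'.-group K by rewrite -eK pcore_pgroup.
    by rewrite /pgroup p'natE // qK.
  have sMK := proper_sub (maxgroupp maxMb).
  have nOG := pcore_normal p G.
  have [M defM sOM' sMG] := inv_quotientS nOG sMK.
  have nOM := normalS sOM' sMG nOG.
  have maxM : maximal M G by rewrite -(quotient_maximal nOM nOG) -defM.
  have defKM : 'O_q(K) * Mb = K.
    apply/eqP; rewrite eqEsubset mul_subG ?pcore_sub //=.
    by rewrite -{1}defK mulgS.
  have hom : K / 'O_q(K) \homg M.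
    apply: (homg_trans (B := M / 'O_p(G))); last by rewrite quotient_homg ?normal_norm.
    rewrite -defM; apply: quotient_mulg_homg defKM.
    exact: subset_trans sMK (gFnorm _ _).
  apply/(pcore_quotient_trivial formh (p := p)).
    apply: pcore_notin_pi; apply: contra p'K; rewrite !mem_primes => /and3P[-> _ pQ].
    by rewrite cardG_gt0 (dvdn_trans pQ) ?dvdn_quotient.
  exact: (pcore_quotient_homg formh hom (maxE M maxM)).
apply: nEG; rewrite /pcore_quotient_class -/K.
apply: (formation_subdirect formh (pcore_normal a K) (pcore_normal b K)); last 2 first.
- exact: hquo.
- exact: hquo.
apply: coprime_TIg; apply: (pnat_coprime (pcore_pgroup a K)).
by apply: (pi_p'group (pcore_pgroup b K)); rewrite !inE.
Qed.

Lemma critical_bound_iterated_local r (h : group_class) :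
  iterated_local r h -> critical_bound h r.+2.
Proof.
elim: r h => [|r IHr] h [formh].
  exact: critical_bound_sub_nilpotent.
case=> g [formg hg itg]; apply: (critical_bound_local formg formh hg) => q q_pr gT G solG maxE nEG.
have [neg | emg] := pselect (class_nonempty (g q)).
  exact: (IHr _ (itg q q_pr neg)).
(* With $g(q)$ empty, no maximal subgroup can satisfy [maxE], so there is none. *)
have G1 : G :=: 1.
  apply/eqP/negPn/negP => ntG.
  have [e | [M maxM _]] := maximal_exists (sub1G G); first by rewrite -e eqxx in ntG.
  by apply: emg; exists _, (M / 'O_q(M))%G; apply: maxE.
by rewrite G1 cards1.
Qed.

(** * n-maximal subgroups *)

(** Modulo its core, [M] supplements a minimal normal $q$-subgroup, so only $q$ can be lost. *)
Lemma primes_maximal_solvable (gT : finGroupType) (G M : {group gT}) :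
  solvable G -> maximal M G -> size (primes #|G|) <= (size (primes #|M|)).+1.
Proof.
move=> solG maxM; have ltMG := maxgroupp maxM; have sMG := proper_sub ltMG.
pose K := gcore M G; have nKG : K <| G := gcore_normal sMG.
have sKM : K \subset M := gcore_sub _ _; have nKM := normalS sKM sMG nKG.
have maxMK : maximal (M / K) (G / K) by rewrite quotient_maximal.
have coreMK := gcore_quotient_gcore sMG.
have ntGK : G / K != 1.
  apply: contraTneq (maxgroupp maxMK) => ->; by rewrite properE sub1G andbF.
have [V minV sVG] := minnormal_exists ntGK (normG (G / K)).
have [_ _ /is_abelemP[q q_pr /abelem_pgroup qV]] :=
  minnormal_solvable minV sVG (quotient_sol _ solG).
have defG := primitive_mulg maxMK coreMK minV sVG.
rewrite -[size (primes #|G|)]count_predT -[size (primes #|M|)]count_predT.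
apply: (@count_primes_leS _ _ q) => l; rewrite !mem_primes !cardG_gt0 /= => /andP[l_pr lG] _.
have dvd_quo : #|G / K| %| #|V| * #|M / K| by rewrite mul_cardG defG dvdn_mulr.
rewrite l_pr /=; move: lG; rewrite -(Lagrange (normal_sub nKG)) Euclid_dvdM //.
rewrite -card_quotient ?normal_norm //; case/orP=> [lK | /dvdn_trans/(_ dvd_quo)].
  by right; rewrite (dvdn_trans lK) ?cardSg.
rewrite Euclid_dvdM //; case/orP => [lV | lM].
  by left; apply/eqP; exact: (pgroupP qV).
by right; rewrite (dvdn_trans lM) ?dvdn_quotient.
Qed.

(** Let $C_{j+1}$ be the first term of the chain containing $M$; maximality of $H$ gives $M\cap C_j
    = H$. The core $N$ of $C_j$ in $C_{j+1}$ meets $M$ inside $H$, and $M/(M\cap N)$ embeds in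
    $C_{j+1}/N$. *)
Lemma F_subnormal_maximal_gcore (F : group_class) (gT : finGroupType) (G M H : {group gT}) :
    formation F ->
    (forall (rT : finGroupType) (X Y : {group rT}),
       solvable X -> Y \subset X -> F _ X -> F _ Y) ->
    solvable G -> M \subset G -> maximal H M -> F_subnormal F H G ->
  F _ (M / gcore H M)%G.
Proof.
move=> formF heredF solG sMG maxH [k [C [C0 Ck chainC]]].
have /andP[sHM nsMH] := maxgroupp maxH.
have exi : exists i, (i <= k) && (M \subset C i) by exists k; rewrite leqnn Ck.
case: (ex_minnP exi) => -[|j] /andP[le_jk sMC] minj.
  by rewrite C0 (negPf nsMH) in sMC.
have nsMCj : ~~ (M \subset C j).
  by apply/negP=> sM; have := minj j; rewrite sM (ltnW le_jk) ltnn => /(_ isT).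
have sHC i : i <= k -> H \subset C i.
  elim: i => [_ | i IHi lt_ik]; first by rewrite C0.
  apply: subset_trans (IHi (ltnW lt_ik)) _.
  exact: proper_sub (maxgroupp (chainC i lt_ik).1).
have sCG i : i <= k -> C i \subset G.
  move=> le_ik; rewrite -Ck -(subnKC le_ik).
  have : i + (k - i) <= k by rewrite subnKC.
  elim: (k - i)%N => [|d IHd]; first by rewrite addn0.
  rewrite addnS => lt_dk; apply: subset_trans (IHd (ltnW lt_dk)) _.
  exact: proper_sub (maxgroupp (chainC _ lt_dk).1).
have [maxCj FCj] := chainC j le_jk.
pose N := gcore (C j) (C j.+1).
have nNC : N <| C j.+1 by apply: gcore_normal; apply: proper_sub (maxgroupp maxCj).
have nNM := subset_trans sMC (normal_norm nNC).
have defH : M :&: C j = H.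
  have [_ maxHM] := maxgroupP maxH.
  apply: (maxHM (M :&: C j)%G); last by rewrite subsetI sHM sHC ?(ltnW le_jk).
  by rewrite properE subsetIl subsetI subxx.
have FM : F _ (M / (N :&: M))%G.
  apply: (formation_isog formF (G := (M / N)%G)).
    by rewrite isog_sym; apply: second_isog.
  apply: heredF FCj; last exact: quotientS.
  by apply: quotient_sol; apply: solvableS (sCG _ le_jk) solG.
apply: (formation_quotientS formF _ (gcore_normal sHM) _ FM).
  by rewrite /normal subsetIr normsI ?normG.
apply: gcore_max; last by rewrite normsI ?normG.
rewrite -defH subsetI subsetIr /=.
exact: subset_trans (subsetIl _ _) (gcore_sub _ _).
Qed.

Theorem theoremA (r n : nat) (F : group_class) (gT : finGroupType)
    (G : {group gT}) :
  1 <= n ->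
  multiply_saturated r F ->
  class_sub nilpotent_groups F ->
  class_sub F (nilpotent_length_le r.+1) ->
  solvable G ->
  (forall H : {group gT}, n_maximal G n H -> F_subnormal F H G) ->
  n + r + 1 <= size (primes #|G|) ->
  F gT G.
Proof.
move=> n_gt0 satF nilF Fnil solG snF leG.
(* By the hypothesis on nilpotent length [E] has the same members as [F], in a form fit for
   [iterated_local]. *)
pose E := class_inter F (fitting_height_le r.+1).
have FE (rT : finGroupType) (K : {group rT}) : F rT K -> E rT K.
  move=> FK; split=> //; have [solK] := Fnil _ _ FK.
  exact: nilpotent_length_fitting_height.
suffices [] : E gT G by [].
have itE : iterated_local r E := multiply_saturated_iterated_local satF.
have formE := iterated_local_formation itE.
have [g formg locE] : exists2 g : nat -> group_class,
    forall p, prime p -> formation (g p)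
    & forall (rT : finGroupType) (K : {group rT}), solvable K -> (E rT K <-> local_class g K).
  (* For $r = 0$ the class is that of all nilpotent groups, which is local with trivial values. *)
  case: (r) E itE FE {formE} => [|r'] E' itE' FE'.
    exists (fun _ => trivial_groups) => [p _ | rT K _]; first exact: trivial_groups_formation.
    rewrite -/(fitting_height_le 1 K); split => [EK | hK].
      by apply/fitting_height_le1; apply: (itE'.2).
    by apply/FE'/nilF/fitting_height_le1.
  by case: itE' => _ [g [formg locE _]]; exists g.
have E1 (rT : finGroupType) (K : {group rT}) : pcore_quotient_class 1%N E K <-> E rT K.
  by apply: pcore_quotient_trivial => //; apply: pcore_notin_pi; rewrite mem_primes.
have satE (K : {group gT}) : solvable K ->
    (forall M : {group gT}, maximal M K -> E _ (K / gcore M K)%G) -> E gT K.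
  move=> solK maxE; apply/E1; apply: pcore_quotient_gcore => //.
  - by exists gT, 1%G; apply/(locE _ _ (solvable1 _)); apply: local_class1.
  - move=> rT H solH /(locE _ _ (quotient_sol _ solH)) lH.
    by apply/(locE _ _ solH); apply: local_class_Phi.
  by move=> M maxM; apply/E1; apply: maxE.
(* [n_maximal] starts at depth 1; depth 0 is added for [G] itself. *)
pose kmax m M := m = 0%N /\ M = G \/ n_maximal G m M.
have kmaxS m (M H : {group gT}) : kmax m M -> maximal H M -> kmax m.+1 H.
  move=> [[-> ->] | maxM] maxH; right; first exact: n_maximal1.
  exact: n_maximalS maxM maxH.
have kmaxP m M : kmax m M -> M \subset G /\ size (primes #|G|) <= size (primes #|M|) + m.
  case=> [[-> ->] | ]; first by rewrite addn0.
  elim=> {m M} [M maxM | m M H _ [sMG leM] maxH].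
    by rewrite addn1 proper_sub ?primes_maximal_solvable ?(maxgroupp maxM).
  split; first exact: subset_trans (proper_sub (maxgroupp maxH)) sMG.
  apply: leq_trans leM _; rewrite addnS -addSn leq_add2r.
  by rewrite primes_maximal_solvable ?(solvableS sMG).
(* Induction on the distance [d] to depth $n-1$, climbing from the $(n-1)$-maximal subgroups to
   [G]. *)
have E_kmax d m M : m + d = n.-1 -> kmax m M -> E gT M.
  elim: d m M => [|d IHd] m M eqn kM; have [sMG leM] := kmaxP m M kM;
    have solM := solvableS sMG solG.
    apply: satE => // H maxH.
    apply: (F_subnormal_maximal_gcore formE _ solG sMG maxH).
      move=> rT X Y solX sYX; exact: iterated_localS itE solX sYX.
    have [[//] | nH] := kmaxS _ _ _ kM maxH.
    rewrite addn0 in eqn; rewrite eqn prednK // in nH.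
    have [k [C [C0 Ck chainC]]] := snF H nH.
    by exists k, C; split=> // i /chainC[maxC FC]; split=> //; apply: FE.
  apply: contrapT => nEM.
  have maxE : maximals_in (pcore_quotient_class 1%N E) M.
    move=> H maxH; apply/E1; apply: (IHd m.+1); first by rewrite addSnnS.
    exact: kmaxS kM maxH.
  have := critical_bound_iterated_local itE solM maxE (fun EM => nEM ((E1 _ M).1 EM)).
  have -> : count (predC1 1%N) (primes #|M|) = size (primes #|M|).
    apply/eqP; rewrite -all_count; apply/allP=> l; rewrite mem_primes => /andP[l_pr _].
    by rewrite /= neq_ltn prime_gt1 ?orbT.
  (* Here $m\le n-2$, so [M] keeps at least $n+r+1-m\ge r+3$ primes, against the critical bound
     $r+2$. *)
  move=> le2; have := leq_trans leG (leq_trans leM (leq_add le2 (leqnn m))).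
  rewrite -(prednK n_gt0) -eqn !addSn !addnS addn0 !ltnS.
  by rewrite addSn addnAC (addnC m) ltnNge leq_addr.
by apply: (E_kmax n.-1 0%N); [rewrite add0n | left].
Qed.
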